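(* Let $H_1,H_2,K_1,K_2$ be Hilbert spaces and let $\mathcal U\subset B(K_1,K_2)$ and $\mathcal V\subset B(H_1,H_2)$ be essential weak* closed subspaces which are weak TRO equivalent. Let $I$ be an infinite cardinal which is greater than or equal to the maximum of $I_1,I_2$, where $I_i$ is the cardinality of an orthonormal basis of $H_i$, $i=1,2$. Then $$k(M_I^w(\mathcal V))\le k(M_I^w(\mathcal U)).$$ In the special case that $H_1,H_2,K_1,K_2$ are separable, $$k(M_\infty^w(\mathcal V))=k(M_\infty^w(\mathcal U)).$$
   Context: Notation: $[\mathcal S]$ is the linear span of $\mathcal S$, and $[\mathcal S]^{-w^*}$ is its weak* closure; for spaces of operators, $\mathcal X\mathcal Y$ is the set of products and $\mathcal X^*=\{X^*:X\in\mathcal X\}$. Essential: a subspace $\mathcal U\subset B(K_1,K_2)$ is essential if $\overline{[\mathcal U K_1]}=K_2$ and $\overline{[\mathcal U^*K_2]}=K_1$. TRO: a subspace $\mathcal M\subset B(H,K)$ is a ternary ring of operators (TRO) if $\mathcal M\mathcal M^*\mathcal M\subset\mathcal M$. Weak TRO equivalence: weak* closed spaces $\mathcal U\subset B(K_1,K_2)$ and $\mathcal V\subset B(H_1,H_2)$ are weak TRO equivalent if there exist TROs $\mathcal M_i\subset B(H_i,K_i)$, $i=1,2$, such that $\mathcal U=[\mathcal M_2\mathcal V\mathcal M_1^*]^{-w^*}$ and $\mathcal V=[\mathcal M_2^*\mathcal U\mathcal M_1]^{-w^*}$. Matrices: for a weak* closed space $\mathcal U\subset B(K_1,K_2)$ and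 a cardinal $I$, $M_I^w(\mathcal U)$ is the space of $I\times I$ matrices with entries in $\mathcal U$ whose finite submatrices have uniformly bounded norm, regarded as a subspace of $B(K_1^I,K_2^I)$, where $K_j^I$ is the Hilbert space direct sum of $I$ copies of $K_j$. $M_\infty^w$ denotes $M_I^w$ with $I=\aleph_0$. Hyperreflexivity constant: for a subspace $\mathcal X\subset B(H,K)$ and $T\in B(H,K)$ put $d(T,\mathcal X)=\inf_{X\in\mathcal X}\|T-X\|$ and $r_{\mathcal X}(T)=\sup\{|\langle T\xi,\eta\rangle|:\|\xi\|=\|\eta\|=1,\ \langle X\xi,\eta\rangle=0\ \forall X\in\mathcal X\}$. One has $r_{\mathcal X}(T)\le d(T,\mathcal X)$. $\mathcal X$ is hyperreflexive if there is $k>0$ with $d(T,\mathcal X)\le k\,r_{\mathcal X}(T)$ for all $T$. The hyperreflexivity constant is $k(\mathcal X)=\sup_{T\notin\mathcal X} d(T,\mathcal X)/r_{\mathcal X}(T)\in[1,\infty]$, with $k(\mathcal X)=\infty$ if $\mathcal X$ is not hyperreflexive and $k(\mathcal X)=1$ if $\mathcal X=B(H,K)$. *)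

(* Defs.v *)
From HB Require Import structures.
From mathcomp Require Import all_boot all_order all_algebra.
From mathcomp Require Import finmap.
From mathcomp Require Import boolp classical_sets functions cardinality.
From mathcomp Require Import reals ereal topology normedtype.
From mathcomp Require summability.
From mathcomp Require Import complex ring.

Set Implicit Arguments.
Unset Strict Implicit.
Unset Printing Implicit Defensive.

Import Order.TTheory GRing.Theory Num.Theory.
Import numFieldNormedType.Exports.

Local Open Scope classical_set_scope.
Local Open Scope ring_scope.

(* The inner product is linear in the first and conjugate-linear in the
   second argument. *)
HB.mixin Record isHilbert (R : realType) H of CompleteNormedModule R[i] H := {
  inner : {dot H for @Num.conj R[i]};
  inner_normE : forall x : H, inner x x = `|x| ^+ 2
}.

#[short(type="hilbertType")]
HB.structure Definition Hilbert (R : realType) :=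
  {H of CompleteNormedModule R[i] H & isHilbert R H}.

Section dot_theory.
Context {C : numClosedFieldType} {U : lmodType C}.
Variable form : {dot U for @Num.conj C}.
Local Notation "''[' u , v ]" := (form u%R v%R).

Lemma dot_ge0 u : 0 <= '[u, u].
Proof.
have [->|u0] := eqVneq u 0; first by rewrite linear0l.
exact/ltW/neq0_dnorm_gt0.
Qed.

Lemma dot_conj u v : '[v, u] = ('[u, v])^*.
Proof. by have := hermC form v u; rewrite expr0 mul1r. Qed.

Lemma dot_CauchySchwarz u v : `|'[u, v]| ^+ 2 <= '[u, u] * '[v, v].
Proof.
have [->|v0] := eqVneq v 0.
  by rewrite !linear0r normr0 expr0n/= mulr0 lexx.
have b0 : 0 < '[v, v] by exact: neq0_dnorm_gt0.
set a := '[u, v]; set b := '[v, v].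
have := dot_ge0 (u - (a / b) *: v).
have br : b^* = b by apply/CrealP/gtr0_real.
rewrite linearBl !linearBr/= !linearZl_LR/= !linearZr_LR/= -/a -/b.
rewrite (dot_conj u v) -/a rmorphM/= fmorphV/= br.
have -> : '[u, u] - a^* / b * a - (a / b * a^* - a / b * (a^* / b * b))
   = '[u, u] - (a * a^*) / b.
  by rewrite divfK ?gt_eqF// subrr subr0 mulrAC [a^* * a]mulrC.
by rewrite subr_ge0 -normCK ler_pdivrMr.
Qed.

Lemma dot_triangle u v :
  sqrtC '[u + v, u + v] <= sqrtC '[u, u] + sqrtC '[v, v].
Proof.
rewrite -[leRHS]sqrCK ?addr_ge0 ?sqrtC_ge0 ?dot_ge0//.
rewrite ler_sqrtC ?nnegrE ?exprn_ge0 ?addr_ge0 ?sqrtC_ge0 ?dot_ge0//.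
rewrite linearDl !linearDr/= sqrrD !sqrtCK.
rewrite [leLHS](_ : _ = '[u, u] + ('[u, v] + '[v, u]) + '[v, v]); last first.
  by rewrite !addrA.
rewrite lerD2r lerD2l.
have CS : `|'[u, v]| <= sqrtC '[u, u] * sqrtC '[v, v].
  rewrite -sqrtCM ?nnegrE ?dot_ge0// -[leLHS]sqrCK//.
  by rewrite ler_sqrtC ?nnegrE ?exprn_ge0 ?mulr_ge0 ?dot_ge0// dot_CauchySchwarz.
rewrite (dot_conj u v).
apply: (le_trans (real_ler_norm _)).
  by apply/CrealP; rewrite rmorphD/= conjCK addrC.
rewrite (le_trans (ler_normD _ _))// norm_conjC -mulr2n.
by rewrite lerMn2r/=.
Qed.

End dot_theory.

#[export] Existing Instance summability.totally_filter.

Section csum.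
Context {K : numClosedFieldType} {I : choiceType}.
Implicit Types (z w : I -> K) (J : {fset I}).

Local Notation psum z := (summability.partial_sum (z : I -> K^o)).

(* The (unconditional) sum of a family of scalars. *)
Definition csum z : K := summability.sum (z : I -> K^o).

Definition abs_summable z :=
  exists M : K, forall J, psum (fun i => `|z i|) J <= M.

Definition csummable z := psum z @ summability.totally --> (csum z : K^o).

Lemma psum_fset z J : psum z J = \sum_(i <- J) z i.
Proof. by rewrite /summability.partial_sum big_seq_fsetE. Qed.

Lemma le_psum z w J : (forall i, z i <= w i) -> psum z J <= psum w J.
Proof. by move=> zw; apply: ler_sum. Qed.

Lemma psum_sub z J J' : (forall i, 0 <= z i) -> (J `<=` J')%fset ->
  psum z J <= psum z J'.
Proof.
move=> z0 JJ'; rewrite !psum_fset.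
pose F i := if i \in J then z i else 0.
rewrite (_ : \sum_(i <- J) z i = \sum_(i <- J) F i); last first.
  by rewrite !big_seq; apply: eq_bigr => i iJ; rewrite /F iJ.
rewrite (big_fset_incl _ JJ'); last first.
  by move=> i _ /negbTE iJ; rewrite /F iJ.
by apply: ler_sum => i _; rewrite /F; case: ifP.
Qed.

Lemma csum_lim z (s : K) :
  psum z @ summability.totally --> (s : K^o) -> csum z = s.
Proof. by move=> H; apply: cvg_lim => //; exact: norm_hausdorff. Qed.

Lemma abs_summable_le z (u : I -> K) (M : K) :
    (forall i, `|z i| <= u i) -> (forall J, psum u J <= M) -> abs_summable z.
Proof.
by move=> zu uM; exists M => J; apply: le_trans (uM J); apply: le_psum.
Qed.

Lemma csummable_nneg :
    (forall z (M : K), (forall i, 0 <= z i) -> (forall J, psum z J <= M) ->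
      exists s : K, psum z @ summability.totally --> (s : K^o)) ->
  forall z, abs_summable z -> csummable z.
Proof.
move=> nneg z [M zM].
have pos w : (forall i, 0 <= w i) -> (forall i, w i <= `|z i| + `|z i|) ->
    exists s : K, psum w @ summability.totally --> (s : K^o).
  move=> w0 wz; apply: (nneg _ (M + M) w0) => J.
  apply: le_trans (lerD (zM J) (zM J)).
  by rewrite /summability.partial_sum -big_split/=; apply: ler_sum.
have [n nE] := pos (fun i => `|z i|) (fun i => normr_ge0 _)
  (fun i => ler_wpDl (normr_ge0 _) (lexx _)).
have sub x : x \is Num.real -> forall y : K, `|x| <= `|y| ->
    0 <= `|y| + x /\ `|y| + x <= `|y| + `|y|.
  move=> xr y xy; rewrite lerD2l (le_trans (real_ler_norm xr))//.
  split => //; rewrite -lerBlDr sub0r (le_trans _ xy)//.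
  by rewrite -normrN real_ler_norm ?realN.
have leR (y : K) : `|'Re y| <= `|y| by case: (leif_normC_Re_Creal y).
have leI (y : K) : `|'Im y| <= `|y|.
  have -> : 'Im y = 'Re (- 'i * y) by rewrite mulNr raddfN/= ReMil opprK.
  by rewrite (le_trans (leR _))// normrM normrN normCi mul1r.
have [a aE] := pos (fun i => `|z i| + 'Re (z i))
   (fun i => (sub _ (Creal_Re _) _ (leR _)).1)
   (fun i => (sub _ (Creal_Re _) _ (leR _)).2).
have [b bE] := pos (fun i => `|z i| + 'Im (z i))
   (fun i => (sub _ (Creal_Im _) _ (leI _)).1)
   (fun i => (sub _ (Creal_Im _) _ (leI _)).2).
suff H : psum z @ summability.totally -->
    ((a - n : K^o) + 'i *: (b - n : K^o) : K^o).
  by rewrite /csummable (csum_lim H).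
rewrite (_ : psum z = fun J =>
   (psum (fun i => `|z i| + 'Re (z i)) J - psum (fun i => `|z i|) J)
   + 'i *: (psum (fun i => `|z i| + 'Im (z i)) J - psum (fun i => `|z i|) J)).
  by apply: cvgD; [exact: cvgB | apply: cvgZr; exact: cvgB].
apply/funext => J; rewrite /summability.partial_sum -!sumrB scaler_sumr.
rewrite -big_split/=; apply: eq_bigr => i _.
have e (x y : K) : x + y - x = y by rewrite addrAC subrr add0r.
by rewrite !e [LHS]Crect.
Qed.

Lemma csum_linear (a : K) z w : csummable z -> csummable w ->
  csum (fun i => a * z i + w i) = a * csum z + csum w.
Proof.
move=> zc wc; apply: csum_lim.
rewrite (_ : summability.partial_sum _ = fun J =>
     a *: (psum z J : K^o) + psum w J).
  by apply: cvgD => //; exact: cvgZr.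
apply/funext => J; rewrite /summability.partial_sum scaler_sumr -big_split/=.
exact: eq_bigr.
Qed.

Lemma csum_conj z : csummable z -> csum (fun i => (z i)^*) = (csum z)^*.
Proof.
move=> zc; apply: csum_lim.
move/cvgrPdist_le : zc => zc; apply/cvgrPdist_le => /= e /zc.
apply: filterS => J.
rewrite /summability.partial_sum -rmorph_sum/=.
by move=> h; rewrite -rmorphB norm_conjC.
Qed.

End csum.

Section csum_complex.
Context {R : realType} {I : choiceType}.
Implicit Types (z w : I -> R[i]) (J : {fset I}).

Local Notation psum z := (summability.partial_sum (z : I -> R[i]^o)).

Lemma csum_nneg_cvg z (M : R[i]) : (forall i, 0 <= z i) ->
    (forall J, psum z J <= M) ->
  exists s : R[i], [/\ psum z @ summability.totally --> (s : R[i]^o),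
    (forall J, psum z J <= s) &
    (forall M', (forall J, psum z J <= M') -> s <= M')].
Proof.
move=> z0 zM.
pose v i := complex.Re (z i).
have vz i : (real_complex R (v i)) = z i by apply: RRe_real; apply: ger0_real.
pose t J := \sum_(i <- J) v i.
have tz J : psum z J = real_complex R (t J).
  by rewrite psum_fset rmorph_sum; apply: eq_bigr => i _; rewrite -vz.
have le_bnd M' : (forall J, psum z J <= M') ->
    (real_complex R (complex.Re M') = M') /\ forall J, t J <= complex.Re M'.
  move=> zM'.
  have M'E : real_complex R (complex.Re M') = M'.
    apply: RRe_real; apply: ger0_real; apply: le_trans (zM' fset0).
    by rewrite psum_fset sumr_ge0.
  by split => // J; rewrite -lecR M'E -tz.
pose S := [set t J | J in [set: {fset I}]].
have S0 : S !=set0 by exists (t fset0), fset0.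
have supS : has_sup S.
  split => //; exists (complex.Re M) => _ [J _ <-].
  by have [_] := le_bnd _ zM; apply.
have ubS J : t J <= sup S by apply: sup_upper_bound => //; exists J.
exists (real_complex R (sup S)); split.
- apply/cvgrPdist_le => /= e e0.
  have eE : real_complex R (complex.Re e) = e.
    by apply: RRe_real; exact: gtr0_real.
  have e0' : 0 < complex.Re e by rewrite -ltcR eE.
  have [_ [J _ <-] lt] := sup_adherent e0' supS.
  exists J => // J' /= JJ'.
  rewrite tz -rmorphB/= ger0_norm ?ler0c ?subr_ge0//.
  rewrite -eE lecR lerBlDr -lerBlDl (le_trans (ltW lt))//.
  by rewrite -lecR -!tz; exact: psum_sub.
- by move=> J; rewrite tz lecR.
- move=> M' zM'; have [<- H] := le_bnd _ zM'.
  by rewrite lecR; apply: ge_sup => // _ [J _ <-].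
Qed.

Lemma csum_cvg z : abs_summable z -> csummable z.
Proof.
apply: csummable_nneg => {}z M z0 zM.
by have [s [? _ _]] := csum_nneg_cvg z0 zM; exists s.
Qed.

Lemma csum_ge z (M : R[i]) : (forall i, 0 <= z i) ->
  (forall J, psum z J <= M) -> forall J, psum z J <= csum z.
Proof.
by move=> z0 zM; have [s [/csum_lim -> + _]] := csum_nneg_cvg z0 zM.
Qed.

Lemma csum_le z (M : R[i]) : (forall i, 0 <= z i) ->
  (forall J, psum z J <= M) -> csum z <= M.
Proof.
by move=> z0 zM; have [s [/csum_lim -> _]] := csum_nneg_cvg z0 zM; apply.
Qed.

End csum_complex.

Section inner_theory.
Context {R : realType} {H : hilbertType R}.

Lemma inner_le (x y : H) : `|inner x y| <= `|x| * `|y|.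
Proof.
rewrite -(@ler_pXn2r _ 2) ?nnegrE ?mulr_ge0// exprMn -!inner_normE.
exact: dot_CauchySchwarz.
Qed.

Lemma inner_le_sq (x y : H) : `|inner x y| <= `|x| ^+ 2 + `|y| ^+ 2.
Proof.
apply: le_trans (inner_le x y) _.
have /orP[xy|yx] := real_leVge (normr_real x) (normr_real y).
  rewrite (le_trans (ler_wpM2r (normr_ge0 _) xy))// -expr2.
  by rewrite lerDr exprn_ge0.
rewrite (le_trans (ler_wpM2l (normr_ge0 _) yx))// -expr2.
by rewrite lerDl exprn_ge0.
Qed.

End inner_theory.

Lemma norm_sqD (R : realType) (V : normedModType R[i]) (x y : V) :
  `|x + y| ^+ 2 <= 2 * `|x| ^+ 2 + 2 * `|y| ^+ 2.
Proof.
apply: (@le_trans _ _ ((`|x| + `|y|) ^+ 2)).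
  by rewrite ler_pXn2r ?nnegrE ?addr_ge0// ler_normD.
rewrite -subr_ge0.
have -> : 2 * `|x| ^+ 2 + 2 * `|y| ^+ 2 - (`|x| + `|y|) ^+ 2 =
  (`|x| - `|y|) ^+ 2 by rewrite !expr2; ring.
by rewrite real_exprn_even_ge0// realB// normr_real.
Qed.

Section hilbert_sum.
Context (R : realType) (I : choiceType) (H : hilbertType R).

Definition square_summable : {pred I -> H} := fun f =>
  `[< exists M : R[i], forall J : {fset I}, \sum_(i <- J) `|f i| ^+ 2 <= M >].

(* The Hilbert space direct sum of I copies of H. *)
Record hilbert_sum := HilbertSum {
  hilbert_sum_fun :> I -> H;
  hilbert_sumP : hilbert_sum_fun \in square_summable
}.

HB.instance Definition _ := [isSub for hilbert_sum_fun].
HB.instance Definition _ := [Choice of hilbert_sum by <:].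

Lemma square_summable_submod_closed : submod_closed square_summable.
Proof.
split.
  by apply/asboolP; exists 0 => J; rewrite big1// => i _; rewrite normr0 expr0n.
move=> a f g /asboolP[M fM] /asboolP[N gN]; apply/asboolP.
exists (2 * `|a| ^+ 2 * M + 2 * N) => J.
apply: le_trans (lerD (ler_wpM2l _ (fM J)) (ler_wpM2l _ (gN J))).
- rewrite !mulr_sumr -big_split/=; apply: ler_sum => i _.
  by rewrite (le_trans (norm_sqD _ _))// normrZ exprMn mulrA.
- by rewrite mulr_ge0// exprn_ge0.
- by [].
Qed.

HB.instance Definition _ := GRing.isSubmodClosed.Build R[i] (I -> H)
  square_summable square_summable_submod_closed.
HB.instance Definition _ := [SubChoice_isSubLmodule of hilbert_sum by <:].

Implicit Types f g : hilbert_sum.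

Definition hilbert_sum_inner f g : R[i] := csum (fun i => inner (f i) (g i)).

Lemma hilbert_sum_bound f : exists M : R[i], forall J : {fset I},
  summability.partial_sum (fun i => `|f i| ^+ 2 : R[i]^o) J <= M.
Proof.
have /asboolP[M fM] := hilbert_sumP f.
by exists M => J; rewrite psum_fset.
Qed.

Lemma hilbert_sum_summable f g : csummable (fun i => inner (f i) (g i)).
Proof.
have [M fM] := hilbert_sum_bound f; have [N gN] := hilbert_sum_bound g.
apply: csum_cvg; apply: (@abs_summable_le _ _ _
  (fun i => `|f i| ^+ 2 + `|g i| ^+ 2) (M + N)).
  by move=> i; exact: inner_le_sq.
move=> J; apply: le_trans (lerD (fM J) (gN J)).
by rewrite /summability.partial_sum -big_split.
Qed.

Lemma hilbert_sum_inner_conj f g :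
  hilbert_sum_inner g f = (hilbert_sum_inner f g)^*.
Proof.
rewrite -csum_conj; last exact: hilbert_sum_summable.
by congr csum; apply/funext => i; rewrite dot_conj.
Qed.

Lemma hilbert_sum_inner_linear a f g h : hilbert_sum_inner (a *: f + g) h =
  a * hilbert_sum_inner f h + hilbert_sum_inner g h.
Proof.
rewrite -csum_linear; [|exact: hilbert_sum_summable..].
by congr csum; apply/funext => i/=; rewrite linearPl.
Qed.

Lemma hilbert_sum_inner_bilinear : bilinear_for
  ( *%R : GRing.Scale.law R[i] R[i])
  (@Num.conj R[i] \; *%R : GRing.Scale.law R[i] R[i]) hilbert_sum_inner.
Proof.
split => h a f g /=; first exact: hilbert_sum_inner_linear.
rewrite hilbert_sum_inner_conj hilbert_sum_inner_linear rmorphD rmorphM/=.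
by rewrite -!hilbert_sum_inner_conj.
Qed.

HB.instance Definition _ := bilinear_isBilinear.Build R[i] hilbert_sum
  hilbert_sum _ _ _ hilbert_sum_inner hilbert_sum_inner_bilinear.

Lemma hilbert_sum_inner_hermitian f g : hilbert_sum_inner f g =
  (-1) ^+ false * Num.conj (hilbert_sum_inner g f).
Proof. by rewrite expr0 mul1r -hilbert_sum_inner_conj. Qed.

HB.instance Definition _ := isHermitianSesquilinear.Build R[i] hilbert_sum
  false (@Num.conj R[i]) hilbert_sum_inner hilbert_sum_inner_hermitian.

Lemma hilbert_sum_innerE f :
  hilbert_sum_inner f f = csum (fun i => `|f i| ^+ 2).
Proof. by congr csum; apply/funext => i; rewrite inner_normE. Qed.

Lemma hilbert_sum_inner_ge f (J : {fset I}) :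
  \sum_(i <- J) `|f i| ^+ 2 <= hilbert_sum_inner f f.
Proof.
have [M fM] := hilbert_sum_bound f.
by rewrite hilbert_sum_innerE -psum_fset (csum_ge _ fM).
Qed.

Lemma hilbert_sum_inner_le f (M : R[i]) :
  (forall J : {fset I}, \sum_(i <- J) `|f i| ^+ 2 <= M) ->
  hilbert_sum_inner f f <= M.
Proof.
move=> fM; rewrite hilbert_sum_innerE csum_le// => J.
by rewrite psum_fset.
Qed.

Lemma hilbert_sum_inner_ge1 f i : `|f i| ^+ 2 <= hilbert_sum_inner f f.
Proof. by have := hilbert_sum_inner_ge f [fset i]%fset; rewrite big_seq_fset1. Qed.

Lemma hilbert_sum_inner_gt0 f : f != 0 -> 0 < hilbert_sum_inner f f.
Proof.
move=> f0; have /existsNP[i /eqP fi0] : ~ forall i, f i = 0.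
  by move=> h; move/eqP : f0; apply; apply/val_inj/funext.
by rewrite (lt_le_trans _ (hilbert_sum_inner_ge1 f i))// exprn_gt0// normr_gt0.
Qed.

HB.instance Definition _ := isDotProduct.Build R[i] hilbert_sum
  hilbert_sum_inner hilbert_sum_inner_gt0.

Definition hilbert_sum_norm f : R[i] := sqrtC (hilbert_sum_inner f f).

Lemma hilbert_sum_normD f g :
  hilbert_sum_norm (f + g) <= hilbert_sum_norm f + hilbert_sum_norm g.
Proof. exact: dot_triangle. Qed.

Lemma hilbert_sum_normZ a f :
  hilbert_sum_norm (a *: f) = `|a| * hilbert_sum_norm f.
Proof.
rewrite /hilbert_sum_norm linearZl_LR linearZr_LR/= mulrA -normCK.
by rewrite rootCMl ?exprn_ge0// sqrCK.
Qed.

Lemma hilbert_sum_norm_eq0 f : hilbert_sum_norm f = 0 -> f = 0.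
Proof.
move=> /eqP; rewrite sqrtC_eq0 => f0; apply/eqP; apply: contraTT f0 => f0.
by rewrite gt_eqF// hilbert_sum_inner_gt0.
Qed.

HB.instance Definition _ := Lmodule_isNormed.Build R[i] hilbert_sum
  hilbert_sum_normD hilbert_sum_normZ hilbert_sum_norm_eq0.

Lemma hilbert_sum_inner_normE f : hilbert_sum_inner f f = `|f| ^+ 2.
Proof. by rewrite sqrtCK. Qed.

Lemma hilbert_sum_norm_ge f i : `|f i| <= `|f|.
Proof.
rewrite -(@ler_pXn2r _ 2) ?nnegrE// -hilbert_sum_inner_normE.
exact: hilbert_sum_inner_ge1.
Qed.

Lemma hilbert_sum_complete (F : set_system hilbert_sum) :
  ProperFilter F -> cauchy F -> cvg F.
Proof.
move=> FF /cauchyP Fc; apply/cvg_ex => /=.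
have coord i : exists l : H, (fun f : hilbert_sum => f i) @ F --> l.
  apply/cvg_ex; apply: cauchy_cvg; apply/cauchyP => e e0.
  have [f Ff] := Fc e e0; exists (f i).
  suff : F [set g : hilbert_sum | ball (f i) e (g i)] by [].
  apply: filterS Ff => g; rewrite -!ball_normE/=.
  by move=> fg; apply: le_lt_trans fg; exact: (hilbert_sum_norm_ge (f - g) i).
have [l lP] := choice coord.
have near_l (s : seq I) (d : R[i]) : 0 < d ->
    F [set f : hilbert_sum | forall i, i \in s -> `|l i - f i| <= d].
  move=> d0; elim: s => [|i s IH]; first by apply: filterE.
  have /cvgrPdist_le/(_ _ d0) := lP i; move: IH; apply: filterS2 => f fs fi j /=.
  by rewrite inE => /predU1P[->|/fs].
have close (e : R[i]) : 0 < e -> F [set f : hilbert_sum |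
    forall J : {fset I}, \sum_(i <- J) `|l i - f i| ^+ 2 <= e ^+ 2].
  move=> e0; have e4 : 0 < e / 4 by rewrite divr_gt0.
  have [f0 Ff0] := Fc _ e4; apply: filterS (Ff0) => f Bf J.
  pose d := e / 2 / (#|` J| + 1)%:R.
  have d0 : 0 < d by rewrite !divr_gt0// ltr0n addn1.
  have [g [Bg gl]] := filter_ex (filterI Ff0 (near_l J d d0)).
  have fg : `|g - f| <= e / 2.
    move: Bf Bg; rewrite -!ball_normE/= => Bf Bg.
    rewrite -(subrKA f0 g (- f)) (le_trans (ler_normD _ _))//.
    rewrite (_ : e / 2 = e / 4 + e / 4); last by field.
    by rewrite lerD// ltW// distrC.
  apply: (@le_trans _ _ (\sum_(i <- J) (2 * `|l i - g i| ^+ 2 +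
                                        2 * `|(g - f) i| ^+ 2))).
    apply: ler_sum => i _; rewrite -(subrKA (g i) (l i) (- f i)).
    exact: norm_sqD (l i - g i) (g i - f i).
  rewrite big_split/= -!mulr_sumr.
  have -> : e ^+ 2 = 2 * (e / 2) ^+ 2 + 2 * (e / 2) ^+ 2.
    by rewrite !expr2; field.
  apply: lerD; rewrite ler_pM2l//; last first.
    apply: le_trans (hilbert_sum_inner_ge (g - f) J) _.
    rewrite hilbert_sum_inner_normE.
    by rewrite ler_pXn2r ?nnegrE ?divr_ge0// ltW.
  apply: (@le_trans _ _ (\sum_(i <- J) d ^+ 2)).
    rewrite !big_seq; apply: ler_sum => i iJ.
    by rewrite ler_pXn2r ?nnegrE ?(ltW d0)// gl.
  rewrite big_const_seq count_predT iter_addr_0 -(mulr_natl (d ^+ 2)).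
  rewrite /d (exprMn 2 (e / 2)) exprVn mulrCA ler_piMr ?exprn_ge0 ?divr_ge0 ?(ltW e0)//.
  rewrite ler_pdivrMr ?exprn_gt0 ?ltr0n ?addn1// mul1r -natrX ler_nat.
  by rewrite (leq_trans (leqnSn _))// -[leqLHS]expn1 leq_pexp2l.
have lsq : l \in square_summable.
  have [f fl] := filter_ex (close 1 ltr01).
  have lf : (fun i => l i - f i) \in square_summable.
    by apply/asboolP; exists (1 ^+ 2).
  rewrite (_ : l = (fun i => l i - f i) + f).
    by rewrite rpredD// hilbert_sumP.
  by apply/funext => i /=; rewrite fctE subrK.
exists (HilbertSum lsq); apply/cvgrPdist_le => /= e e0.
apply: filterS (close _ e0) => f fJ.
rewrite -(@ler_pXn2r _ 2) ?nnegrE// ?(ltW e0)// -hilbert_sum_inner_normE.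
exact: hilbert_sum_inner_le.
Qed.

HB.instance Definition _ :=
  Uniform_isComplete.Build hilbert_sum hilbert_sum_complete.

HB.instance Definition _ := isHilbert.Build R hilbert_sum
  hilbert_sum_inner_normE.

End hilbert_sum.

Section bounded_operators.
Context {R : realType}.
Implicit Types G H K : hilbertType R.

Definition bounded_linear H K : {pred H -> K} :=
  fun f => `[< linear f /\ continuous f >].

(* B(H, K) *)
Record bop H K := Bop {
  bop_fun :> H -> K;
  bopP : bop_fun \in @bounded_linear H K
}.

HB.instance Definition _ H K := [isSub for @bop_fun H K].
HB.instance Definition _ H K := [Choice of bop H K by <:].

Lemma bounded_linear_submod_closed H K : submod_closed (@bounded_linear H K).
Proof.
split.
  apply/asboolP; split; last exact: cst_continuous.
  by move=> a x y /=; rewrite scaler0 addr0.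
move=> a f g /asboolP[fl fc] /asboolP[gl gc]; apply/asboolP; split.
  move=> b x y /=; rewrite !fctE fl gl scalerDr scalerDr !scalerA mulrC.
  by rewrite addrACA.
by move=> x; apply: cvgD; [apply: cvgZr; exact: fc|exact: gc].
Qed.

HB.instance Definition _ H K := GRing.isSubmodClosed.Build R[i] (H -> K)
  (@bounded_linear H K) (@bounded_linear_submod_closed H K).
HB.instance Definition _ H K := [SubChoice_isSubLmodule of bop H K by <:].

Lemma bop_linear H K (T : bop H K) : linear T.
Proof. by have /asboolP[] := bopP T. Qed.

Lemma bop_continuous H K (T : bop H K) : continuous T.
Proof. by have /asboolP[] := bopP T. Qed.

HB.instance Definition _ H K (T : bop H K) :=
  GRing.isLinear.Build R[i] H K _ T (bop_linear T).

Lemma bop_comp_subproof G H K (S : bop H K) (T : bop G H) :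
  S \o T \in @bounded_linear G K.
Proof.
apply/asboolP; split; first by move=> a x y /=; rewrite !linearP.
move=> x; apply: continuous_comp; exact: bop_continuous.
Qed.

Definition bop_comp G H K (S : bop H K) (T : bop G H) : bop G K :=
  Bop (bop_comp_subproof S T).

Definition is_adjoint H K (T : bop H K) (S : bop K H) :=
  forall x y, inner (T x) y = inner x (S y).

(* The norm of a normed module over R[i] takes its values in R[i]. *)
Definition rnorm (V : normedZmodType R[i]) (x : V) : R := complex.Re `|x|.

Definition opnorm H K (T : bop H K) : R :=
  sup [set rnorm (T x) | x in [set x : H | rnorm x <= 1]].

End bounded_operators.

Section spans.
Context {R : realType}.

Definition subspace_set (V : lmodType R[i]) (X : set V) :=
  X 0 /\ forall (a : R[i]) x y, X x -> X y -> X (a *: x + y).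

Definition linear_span (V : lmodType R[i]) (X : set V) : set V :=
  [set x | exists n (c : 'I_n -> R[i]) (s : 'I_n -> V),
    (forall i, X (s i)) /\ x = \sum_i c i *: s i].

End spans.

Section operator_spaces.
Context {R : realType}.
Implicit Types G H K : hilbertType R.

Definition mul_set G H K (X : set (bop H K)) (Y : set (bop G H)) :
  set (bop G K) := [set bop_comp S T | S in X & T in Y].

Definition adjoint_set H K (X : set (bop H K)) : set (bop K H) :=
  [set S | exists2 T, X T & is_adjoint T S].

Definition essential H K (X : set (bop H K)) :=
  closure (linear_span [set T x | T in X & x in [set: H]]) = [set: K] /\
  closure (linear_span [set S y | S in adjoint_set X & y in [set: K]]) =
    [set: H].

(* The normal functionals on B(H, K), i.e. those given by the trace class
   operators from K to H, are T |-> \sum_n <T x_n, y_n> for square summable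
   sequences x and y. *)
Definition normal_eval H K (T : bop H K)
    (p : hilbert_sum nat H * hilbert_sum nat K) : R[i]^o :=
  csum (fun n => inner (T (p.1 n)) (p.2 n)).

(* B(H, K) with its weak* topology *)
Definition weakstar H K : topologicalType := initial_topology
  (@normal_eval H K : bop H K -> {ptws _ -> R[i]^o}).

Definition weakstar_closed H K (X : set (bop H K)) :=
  closed (X : set (weakstar H K)).

Definition weakstar_closure H K (X : set (bop H K)) : set (bop H K) :=
  closure (X : set (weakstar H K)).

Definition TRO H K (M : set (bop H K)) :=
  subspace_set M /\ mul_set (mul_set M (adjoint_set M)) M `<=` M.

Definition weak_TRO_equivalent (H1 H2 K1 K2 : hilbertType R)
    (U : set (bop K1 K2)) (V : set (bop H1 H2)) :=
  exists (M1 : set (bop H1 K1)) (M2 : set (bop H2 K2)),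
    [/\ TRO M1, TRO M2,
      U = weakstar_closure
        (linear_span (mul_set (mul_set M2 V) (adjoint_set M1))) &
      V = weakstar_closure
        (linear_span (mul_set (mul_set (adjoint_set M2) U) M1))].

Definition bounded_submatrices (I : choiceType) H K (A : I -> I -> bop H K) :=
  exists2 M : R[i], 0 <= M &
    forall (J L : {fset I}) (x : I -> H),
      \sum_(i <- J) `|\sum_(j <- L) A i j (x j)| ^+ 2 <=
        M ^+ 2 * \sum_(j <- L) `|x j| ^+ 2.

(* T is the operator given by the matrix A: (T x)_i = \sum_j A_ij x_j. *)
Definition matrix_of (I : choiceType) H K (A : I -> I -> bop H K)
    (T : bop (hilbert_sum I H) (hilbert_sum I K)) :=
  forall (x : hilbert_sum I H) (i : I),
    summability.partial_sum (fun j => A i j (x j)) @ summability.totally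
      --> T x i.

(* M_I^w(X) *)
Definition matrix_space (I : choiceType) H K (X : set (bop H K)) :
    set (bop (hilbert_sum I H) (hilbert_sum I K)) :=
  [set T | exists A : I -> I -> bop H K,
    [/\ forall i j, X (A i j), bounded_submatrices A & matrix_of A T]].

Definition op_dist H K (X : set (bop H K)) (T : bop H K) : R :=
  inf [set opnorm (T - S) | S in X].

(* If there are no admissible unit vectors, r_X(T) = sup set0 = 0. *)
Definition op_r H K (X : set (bop H K)) (T : bop H K) : R :=
  sup [set r | exists x y,
    [/\ rnorm x = 1, rnorm y = 1, (forall S, X S -> inner (S x) y = 0) &
        r = rnorm (inner (T x) y)]].

Definition hyperreflexive H K (X : set (bop H K)) :=
  exists2 k : R, 0 < k & forall T, op_dist X T <= k * op_r X T.

(* When X is hyperreflexive, op_r X T = 0 only if op_dist X T = 0, so the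
   convention x / 0 = 0 is harmless. *)
Definition hyperreflexivity_constant H K (X : set (bop H K)) : \bar R :=
  if `[< X = [set: bop H K] >] then 1%E
  else if `[< hyperreflexive X >] then
    ereal_sup [set (op_dist X T / op_r X T)%:E | T in ~` X]
  else +oo%E.

Definition orthonormal_basis H (E : set H) :=
  [/\ forall e, E e -> `|e| = 1,
      forall e f, E e -> E f -> e <> f -> inner e f = 0 &
      closure (linear_span E) = [set: H]].

Definition separable H := exists D : set H, countable D /\ dense D.

End operator_spaces.

Arguments matrix_space {R} I {H K} X.
Arguments hilbert_sum {R} I H.

(* Main.v *)
Require Import Defs.
From HB Require Import structures.
From mathcomp Require Import all_boot all_order all_algebra.
From mathcomp Require Import finmap.
From mathcomp Require Import boolp classical_sets functions cardinality.
From mathcomp Require Import reals ereal topology normedtype.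
From mathcomp Require summability.
From mathcomp Require Import complex ring.

(** Put [MV] and [MU] for the matrix spaces over [V] and [U], and let [M1], [M2]
    be the TROs that implement the equivalence.  The heart of the matter is a
    compression argument.  Suppose that [W1], [W2] are contractions, with
    finitely many nonzero entries, taken from [M1] and [M2].  Then
    [Y |-> W2 Y W1^*] maps [MV] into [MU] and [X |-> W2^* X W1] maps [MU] into
    [MV] ([matrix_space_transfer]).  The first fact shows that [T' = W2 T W1^*]
    satisfies [r_MU (T') <= r_MV (T)]: a pair [x, y] that [MU] does not see gives
    the pair [W1^* x, W2^* y] that [MV] does not see.  If [k] is a
    hyperreflexivity constant of [MU], then some [X] in [MU] is within about
    [k * r_MV (T)] of [T'], and by the second fact [Y = W2^* X W1] is an element
    of [MV] within the same distance of [W2^* W2 T W1^* W1].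

    It remains to let [W1^* W1] and [W2^* W2] tend to the identity.

    - Such [W] exist.  As [V] is essential, the ranges of the adjoints of the
      elements of [Mi] span a dense subspace.  Since [I] is infinite, finitely
      many vectors of these ranges can be stacked in separate rows, so they are
      in the range of [c^*] for one finite matrix [c]
      ([finite_matrices_range]).  The Newton-Schulz iteration
      [x |-> 3/2 x - 1/2 x x^* x] for the polar decomposition of [c] does not
      leave the TRO of finite matrices, and it makes [1 - x^* x] small on the
      range of [c^*] ([newton_iter], [defect_iter_le], [tro_approximation]).

    - The limit exists.  The operators [Y] are bounded, so along an ultrafilter
      they converge in the weak operator topology ([wot_limit]).  On bounded
      sets this is weak* convergence ([wot_cvg_normal_eval]), and a matrix
      belongs to [MV] as soon as its entries belong to [V] ([matrix_spaceE]), so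
      the limit is in [MV] ([matrix_space_compactness]).  It is within
      [k * r_MV (T)] of [T], up to an arbitrarily small error
      ([op_dist_transfer]).

    The equality for separable spaces consists of the inequality for [I = nat]
    and the one with [U] and [V] exchanged, as adjoints turn the given TROs into
    TROs for the reversed equivalence ([weak_TRO_equivalent_sym]). *)

Import Order.TTheory GRing.Theory Num.Theory.
Import numFieldNormedType.Exports.

Local Open Scope classical_set_scope.
Local Open Scope card_scope.
Local Open Scope ring_scope.

Set Implicit Arguments.
Unset Strict Implicit.
Unset Printing Implicit Defensive.

(** * Inner products *)

Section inner_product.
Context {R : realType} {H : hilbertType R}.
Implicit Types (x y z : H) (a : R[i]).

Lemma innerDl x y z : inner (x + y) z = inner x z + inner y z.
Proof. exact: linearDl. Qed.

Lemma innerDr x y z : inner z (x + y) = inner z x + inner z y.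
Proof. exact: linearDr. Qed.

Lemma innerBl x y z : inner (x - y) z = inner x z - inner y z.
Proof. exact: linearBl. Qed.

Lemma innerBr x y z : inner z (x - y) = inner z x - inner z y.
Proof. exact: linearBr. Qed.

Lemma innerZl a x y : inner (a *: x) y = a * inner x y.
Proof. exact: linearZl_LR. Qed.

Lemma innerZr a x y : inner x (a *: y) = a^* * inner x y.
Proof. exact: linearZr_LR. Qed.

Lemma inner0l x : inner 0 x = 0.
Proof. exact: linear0l. Qed.

Lemma inner0r x : inner x 0 = 0.
Proof. exact: linear0r. Qed.

Lemma innerC x y : inner y x = (inner x y)^*.
Proof. exact: dot_conj. Qed.

Lemma inner_sumr (I : Type) (s : seq I) (F : I -> H) x :
  inner x (\sum_(i <- s) F i) = \sum_(i <- s) inner x (F i).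
Proof. by rewrite linear_sum. Qed.

Lemma inner_suml (I : Type) (s : seq I) (F : I -> H) x :
  inner (\sum_(i <- s) F i) x = \sum_(i <- s) inner (F i) x.
Proof. by rewrite linear_sumlz. Qed.

Lemma inner_ext x y : (forall z, inner z x = inner z y) -> x = y.
Proof.
move=> xy; apply/eqP; rewrite -subr_eq0 -normr_eq0 -sqrf_eq0 -inner_normE.
by rewrite innerBr xy subrr.
Qed.

Lemma inner_extl x y : (forall z, inner x z = inner y z) -> x = y.
Proof. by move=> xy; apply: inner_ext => z; rewrite innerC xy -innerC. Qed.

Lemma ler_sqr_ge0 a b : 0 <= b -> 0 <= a -> (a ^+ 2 <= b ^+ 2) = (a <= b).
Proof. by move=> b0 a0; rewrite ler_pXn2r. Qed.

End inner_product.

(** * Riesz representation *)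

Section riesz.
Context {R : realType} {H : hilbertType R}.
Implicit Types (x y z : H) (a : R[i]).

Lemma inner_addZ_sq y z a : `|y + a *: z| ^+ 2 =
  `|y| ^+ 2 + (a * inner z y + (a * inner z y)^*) + `|a| ^+ 2 * `|z| ^+ 2.
Proof.
rewrite -!inner_normE innerDl !innerDr !innerZl !innerZr normCK rmorphM/=.
by rewrite -(innerC z y); ring.
Qed.

(** For a bounded linear [f], the minimizer of [|y|^2 - 2 Re (f y)] on a subspace
    is the vector representing [f] there. *)
Definition riesz_functional (f : H -> R[i]) y := `|y| ^+ 2 - (f y + (f y)^*).

Lemma conjC_add_real (w : R[i]) : w + w^* \is Num.real.
Proof. by apply/CrealP; rewrite rmorphD/= conjCK addrC. Qed.

(** An approximate minimizer of [riesz_functional] on [D] approximately represents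
    [f]: moving from [y] along [z] can lower the functional by
    [|inner z y - f z|^2 / |z|^2], which is at most the distance to the infimum.
    This form needs no control of the functional at a limit point. *)
Lemma riesz_approx (D : set H) (f : H -> R[i]) (c e : R[i]) :
    subspace_set D -> (forall a x y, f (a *: x + y) = a * f x + f y) ->
    0 <= c -> (forall x, `|f x| <= c * `|x|) -> 0 < e ->
  exists2 y, D y & forall z, D z -> `|inner z y - f z| <= e * `|z|.
Proof.
move=> [D0 DP] flin c0 fc e0.
have Jreal y : riesz_functional f y \is Num.real.
  by rewrite rpredB ?conjC_add_real// rpredX ?normr_real.
have eR (x : R[i]) : x \is Num.real -> (complex.Re x)%:C%C = x by exact: RRe_real.
have Jlb y : - c ^+ 2 <= riesz_functional f y.
  have : f y + (f y)^* <= 2 * c * `|y|.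
    apply: le_trans (real_ler_norm (conjC_add_real _)) _.
    apply: le_trans (ler_normD _ _) _; rewrite norm_conjC.
    by apply: le_trans (lerD (fc y) (fc y)) _; rewrite -mulr2n -mulrA mulr_natl.
  rewrite -subr_ge0 => fle; rewrite -subr_ge0 /riesz_functional.
  have -> : `|y| ^+ 2 - (f y + (f y)^*) - - c ^+ 2 =
     (2 * c * `|y| - (f y + (f y)^*)) + (`|y| - c) ^+ 2 by ring.
  by rewrite addr_ge0// real_exprn_even_ge0// rpredB ?normr_real ?ger0_real.
pose E := [set complex.Re (riesz_functional f y) | y in D].
have infE : has_inf E.
  split; first by exists (complex.Re (riesz_functional f 0)), 0.
  exists (complex.Re (- c ^+ 2)) => _ [y _ <-].
  by rewrite -lecR !eR// rpredN rpredX// ger0_real.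
have e2 : 0 < complex.Re (e ^+ 2).
  by rewrite -ltcR eR ?exprn_gt0// rpredX// gtr0_real.
have [_ [y Dy <-] ylt] := inf_adherent e2 infE.
exists y => // z Dz.
have [->|z0] := eqVneq z 0.
  have f0 : f 0 = 0.
    by have := flin (-1) 0 0; rewrite scaleN1r oppr0 addr0 mulN1r addNr.
  by rewrite inner0l f0 subrr !normr0 mulr0.
set d := inner z y - f z.
have nz : 0 < `|z| by rewrite normr_gt0.
(* this step minimizes the functional on the line through y in direction z *)
pose a := - d^* / `|z| ^+ 2.
have Ja : riesz_functional f (y + a *: z) =
    riesz_functional f y - `|d| ^+ 2 / `|z| ^+ 2.
  rewrite /riesz_functional inner_addZ_sq addrC (addrC y) flin.
  have -> : a * f z + f y + (a * f z + f y)^* =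
     (f y + (f y)^*) + (a * f z + (a * f z)^*) by rewrite rmorphD/=; ring.
  have ad : a * inner z y = a * d + a * f z by rewrite -mulrDr subrK.
  rewrite ad rmorphD/=.
  have ade : a * d = - (`|d| ^+ 2 / `|z| ^+ 2).
    by rewrite /a normCK; field; rewrite gt_eqF.
  have zr : (`|z| ^+ 2)^* = `|z| ^+ 2 by rewrite conj_Creal// rpredX ?normr_real.
  have adc : (a * d)^* = a * d.
    by rewrite conj_Creal// ade rpredN rpred_div// rpredX ?normr_real.
  have -> : `|a| ^+ 2 * `|z| ^+ 2 = - (a * d).
    rewrite ade opprK /a mulNr normrN normrM norm_conjC normfV normrX normr_id.
    by field; rewrite gt_eqF.
  by rewrite adc -ade; ring.
have Jle : `|d| ^+ 2 / `|z| ^+ 2 <= e ^+ 2.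
  have : complex.Re (riesz_functional f y) <=
     complex.Re (riesz_functional f (y + a *: z)) + complex.Re (e ^+ 2).
    apply: le_trans (ltW ylt) _; rewrite lerD2r.
    apply: inf_lbound; first by case: infE.
    by exists (y + a *: z) => //; rewrite addrC; exact: DP.
  rewrite -lecR rmorphD/= !eR// ?rpredX ?gtr0_real//.
  rewrite Ja -subr_ge0 => h; rewrite -subr_ge0.
  by have -> : e ^+ 2 - `|d| ^+ 2 / `|z| ^+ 2 = riesz_functional f y -
    `|d| ^+ 2 / `|z| ^+ 2 + e ^+ 2 - riesz_functional f y by ring.
rewrite ler_pdivrMr ?exprn_gt0// -exprMn in Jle.
by rewrite -ler_sqr_ge0 ?mulr_ge0// ltW.
Qed.

(** Two approximately representing vectors are close to each other, so the
    approximately representing vectors form a Cauchy filter.  For [D] the whole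
    space this is the representation theorem, and for [f = inner _ z] it yields
    the orthogonal projection of [z] on [D]. *)
Lemma riesz (D : set H) (f : H -> R[i]) (c : R[i]) :
    subspace_set D -> closed D -> (forall a x y, f (a *: x + y) = a * f x + f y) ->
    0 <= c -> (forall x, `|f x| <= c * `|x|) ->
  exists2 y, D y & forall z, D z -> f z = inner z y.
Proof.
move=> Ds Dc flin c0 fc; have [D0 DP] := Ds.
pose A e := [set y | D y /\ forall z, D z -> `|inner z y - f z| <= e * `|z|].
pose F := filter_from [set e : R[i] | 0 < e] A.
have FF : ProperFilter F.
  apply: filter_from_proper; last first.
    move=> e /= e0; have [y Dy yP] := riesz_approx Ds flin c0 fc e0.
    by exists y.
  apply: filter_from_filter; first by exists 1 => /=.
  move=> e e' /= e0 e'0.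
  have [m [m0 [me me']]] : exists m : R[i], 0 < m /\ m <= e /\ m <= e'.
    have /orP[ee'|ee'] := real_leVge (gtr0_real e0) (gtr0_real e'0).
      by exists e.
    by exists e'.
  exists m => // y [Dy yP]; split; split => // z Dz.
    by apply: le_trans (yP _ Dz) _; exact: ler_wpM2r.
  by apply: le_trans (yP _ Dz) _; exact: ler_wpM2r.
have close e e' y y' : A e y -> A e' y' -> 0 < e -> 0 < e' -> `|y - y'| <= e + e'.
  move=> [Dy yP] [Dy' yP'] e0 e'0.
  have Dyy' : D (y - y') by rewrite addrC -scaleN1r; exact: DP.
  have [->|yy'0] := eqVneq y y'; first by rewrite subrr normr0 addr_ge0// ltW.
  have nz : 0 < `|y - y'| by rewrite normr_gt0 subr_eq0.
  rewrite -(ler_pM2r nz) -expr2 -inner_normE mulrDl.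
  have h : `|inner (y - y') (y - y')| <= e * `|y - y'| + e' * `|y - y'|.
    rewrite innerBr.
    rewrite (_ : _ - _ = (inner (y - y') y - f (y - y'))
      - (inner (y - y') y' - f (y - y'))); last by ring.
    apply: le_trans (ler_normB _ _) _; apply: lerD; [exact: yP|exact: yP'].
  apply: le_trans h; rewrite real_ler_norm//.
  by rewrite inner_normE rpredX ?normr_real.
have cF : cvg F.
  apply: cauchy_cvg; apply/cauchyP => e e0.
  have e4 : 0 < e / 4 by rewrite divr_gt0.
  have [y Dy yP] := riesz_approx Ds flin c0 fc e4.
  exists y; exists (e / 4) => // y' Ay'; rewrite -ball_normE/=.
  apply: (@le_lt_trans _ _ (e / 4 + e / 4)); first by apply: close => //.
  by rewrite -subr_gt0 (_ : _ - _ = e / 2) ?divr_gt0//; field.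
have [y0 Fy0] : exists y0, F --> y0 by apply/cvg_ex.
exists y0.
  apply: (@closed_cvg _ _ F _ id D Dc) => //.
  by exists 1 => //= y [].
move=> z Dz; apply/eqP; rewrite eq_sym -subr_eq0 -normr_le0; apply/ler_addgt0Pl => e e0.
have zp : 0 < `|z| + 1 by rewrite ltr_wpDl.
pose d := e / 2 / (`|z| + 1).
have d0 : 0 < d by rewrite !divr_gt0.
have [y [[Dy yP] yd]] : exists y, A d y /\ `|y0 - y| <= d.
  apply/(@filter_ex _ F); apply: filterI; first by exists d.
  by have /cvgrPdist_le/(_ _ d0) : id @ F --> y0 by [].
rewrite (_ : _ - _ = inner z (y0 - y) + (inner z y - f z)); last first.
  by rewrite innerBr; ring.
apply: le_trans (ler_normD _ _) _.
apply: (@le_trans _ _ (`|z| * d + d * `|z|)).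
  apply: lerD; last exact: yP.
  by apply: le_trans (inner_le _ _) _; exact: ler_wpM2l.
rewrite addr0 (_ : _ + _ = e * (`|z| / (`|z| + 1))); last first.
  by rewrite /d; field; rewrite gt_eqF.
by rewrite ler_piMr ?(ltW e0)// ler_pdivrMr// mul1r lerDl.
Qed.

End riesz.

(** * Bounded operators, adjoints and density *)

Section operators.
Context {R : realType}.
Implicit Types (G H K : hilbertType R) (a c : R[i]).

Lemma bop_ext H K (S T : bop H K) : S =1 T -> S = T.
Proof. by move=> ST; apply/val_inj/funext. Qed.

Lemma bopDE H K (S T : bop H K) x : (S + T) x = S x + T x.
Proof. by []. Qed.

Lemma bopBE H K (S T : bop H K) x : (S - T) x = S x - T x.
Proof. by []. Qed.

Lemma bopZE H K a (T : bop H K) x : (a *: T) x = a *: T x.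
Proof. by []. Qed.

(** A bound with values in [R[i]], where the norms live. *)
Definition bounded_by H K (T : H -> K) c := forall x, `|T x| <= c * `|x|.

Lemma bop_exists H K (f : H -> K) c : linear f -> 0 <= c -> bounded_by f c ->
  exists T : bop H K, T =1 f.
Proof.
move=> fl c0 fc.
pose g : {linear H -> K} := HB.pack f (GRing.isLinear.Build _ _ _ _ f fl).
have gc : continuous g.
  apply: bounded_linear_continuous; apply/linear_boundedP.
  apply: filterS (nbhs_pinfty_ge (ger0_real c0)) => r cr x.
  by apply: le_trans (fc x) _; exact: ler_wpM2r.
have fP : f \in @bounded_linear R H K by apply/asboolP.
by exists (Bop fP).
Qed.

Lemma bop_bounded H K (T : bop H K) : exists2 c : R[i], 0 < c & bounded_by T c.
Proof.
have /linear_boundedP : bounded_near T (nbhs 0).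
  by apply: continuous_linear_bounded; exact: bop_continuous.
by move/pinfty_ex_gt0 => [c c0 cT]; exists c.
Qed.

Lemma subspace_setT (V : lmodType R[i]) : subspace_set [set: V].
Proof. by []. Qed.

(** The Riesz theorem in the second variable turns a bounded sesquilinear form into
    an operator.  Both adjoints and weak operator limits are obtained this way. *)
Lemma sesquilinear_bop H K (l : H -> K -> R[i]) c : 0 <= c ->
    (forall a x x' y, l (a *: x + x') y = a * l x y + l x' y) ->
    (forall a x y y', l x (a *: y + y') = a^* * l x y + l x y') ->
    (forall x y, `|l x y| <= c * `|x| * `|y|) ->
  exists2 T : bop H K, forall x y, inner (T x) y = l x y & bounded_by T c.
Proof.
move=> c0 lD lDr lc.
have f_ex x : exists t, forall y, inner t y = l x y.
  have [||a y y'|||t _ tP] := @riesz R K setT (fun y => (l x y)^*) (c * `|x|).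
  - exact: subspace_setT.
  - exact: closedT.
  - by rewrite lDr rmorphD rmorphM/= conjCK.
  - by rewrite mulr_ge0.
  - by move=> y; rewrite norm_conjC.
  by exists t => y; rewrite innerC -tP// conjCK.
have [f fP] := choice f_ex.
have fl : linear f.
  by move=> a x x'; apply: inner_extl => y; rewrite innerDl innerZl !fP lD.
have fc : bounded_by f c.
  move=> x; have [->|f0] := eqVneq (f x) 0; first by rewrite normr0 mulr_ge0.
  have nz : 0 < `|f x| by rewrite normr_gt0.
  rewrite -(ler_pM2r nz) -expr2 -inner_normE fP; apply: le_trans (lc _ _).
  by rewrite real_ler_norm// -fP inner_normE rpredX ?normr_real.
have [T TP] := bop_exists fl c0 fc.
by exists T => x; [move=> y|]; rewrite TP.
Qed.

Lemma adjoint_exists H K (T : bop H K) : exists S, is_adjoint T S.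
Proof.
have [c c0 Tc] := bop_bounded T.
have [||||S SP _] := @sesquilinear_bop K H (fun y x => inner y (T x)) c.
- exact: ltW.
- by move=> a x x' y; rewrite innerDl innerZl.
- by move=> a x y y'; rewrite linearP innerDr innerZr.
- move=> y x; apply: le_trans (inner_le _ _) _.
  by rewrite mulrC mulrAC ler_wpM2r// Tc.
by exists S => x y; rewrite (innerC y) -SP -innerC.
Qed.

Definition adj H K (T : bop H K) : bop K H := projT1 (cid (adjoint_exists T)).

Lemma adjP H K (T : bop H K) x y : inner (T x) y = inner x (adj T y).
Proof. exact: (projT2 (cid (adjoint_exists T))). Qed.

Lemma adjPr H K (T : bop H K) x y : inner y (T x) = inner (adj T y) x.
Proof. by rewrite (innerC (T x)) adjP -innerC. Qed.

Lemma adj_unique H K (T : bop H K) S : is_adjoint T S -> S = adj T.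
Proof.
by move=> TS; apply: bop_ext => y; apply: inner_ext => x; rewrite -TS adjP.
Qed.

Lemma adjK H K (T : bop H K) : adj (adj T) = T.
Proof. by apply/esym/adj_unique => x y; rewrite adjPr. Qed.

Lemma adj_linear H K a (T S : bop H K) :
  adj (a *: T + S) = a^* *: adj T + adj S.
Proof.
apply/esym/adj_unique => x y; rewrite bopDE bopZE innerDl innerZl !adjP.
by rewrite innerDr innerZr conjCK.
Qed.

Lemma adj_comp G H K (S : bop H K) (T : bop G H) :
  adj (bop_comp S T) = bop_comp (adj T) (adj S).
Proof. by apply/esym/adj_unique => x y /=; rewrite !adjP. Qed.

Lemma adj_bounded H K (T : bop H K) c : 0 <= c -> bounded_by T c ->
  bounded_by (adj T) c.
Proof.
move=> c0 Tc y; have [->|nz] := eqVneq (adj T y) 0.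
  by rewrite normr0 mulr_ge0.
have {}nz : 0 < `|adj T y| by rewrite normr_gt0.
rewrite -(ler_pM2r nz) -expr2 -inner_normE -adjP.
apply: le_trans (real_ler_norm _) _.
  by rewrite adjP inner_normE rpredX ?normr_real.
apply: le_trans (inner_le _ _) _.
by rewrite mulrAC ler_wpM2r.
Qed.

Lemma adjoint_setE H K (X : set (bop H K)) S :
  adjoint_set X S <-> X (adj S).
Proof.
split=> [[T XT /adj_unique ->]|XS]; first by rewrite adjK.
by exists (adj S) => // x y; rewrite adjP adjK.
Qed.

Lemma bounded_by_comp G H K (S : bop H K) (T : bop G H) c d :
  0 <= c -> bounded_by S c -> bounded_by T d -> bounded_by (bop_comp S T) (c * d).
Proof.
move=> c0 Sc Td x /=; apply: le_trans (Sc _) _.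
by rewrite -mulrA ler_wpM2l.
Qed.

Lemma bounded_by_inner H K (T : bop H K) c x y : bounded_by T c ->
  `|inner (T x) y| <= c * `|x| * `|y|.
Proof.
by move=> Tc; apply: le_trans (inner_le _ _) _; rewrite ler_wpM2r.
Qed.

End operators.

Section density.
Context {R : realType}.
Implicit Types (H : hilbertType R).

Lemma linear_span_min (V : lmodType R[i]) (X P : set V) :
  subspace_set P -> X `<=` P -> linear_span X `<=` P.
Proof.
move=> [P0 PD] XP _ [n [c [s [Xs ->]]]].
elim: n c s Xs => [|n IH] c s Xs; first by rewrite big_ord0.
by rewrite big_ord_recl; apply: PD; [exact/XP/Xs|apply: IH => i; exact: Xs].
Qed.

Lemma linear_span_subspace (V : lmodType R[i]) (X : set V) :
  subspace_set (linear_span X).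
Proof.
split.
  by exists 0%N, (fun=> 0), (fun=> 0); split; [case|rewrite big_ord0].
move=> a _ _ [n [c [s [Xs ->]]]] [m [d [t [Xt ->]]]].
exists (n + m)%N, (fun i : 'I_(n + m) =>
    match fintype.split i with inl j => a * c j | inr j => d j end),
  (fun i : 'I_(n + m) =>
    match fintype.split i with inl j => s j | inr j => t j end); split.
  by move=> i; case: fintype.split.
rewrite big_split_ord/= scaler_sumr; congr (_ + _); apply: eq_bigr => i _.
  by rewrite (unsplitK (inl i : 'I_n + 'I_m)) scalerA.
by rewrite (unsplitK (inr i : 'I_n + 'I_m)).
Qed.

Lemma sub_linear_span (V : lmodType R[i]) (X : set V) : X `<=` linear_span X.
Proof.
move=> x Xx; exists 1%N, (fun=> 1), (fun=> x); split=> //.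
by rewrite big_ord1 scale1r.
Qed.

Lemma closure_dist H (X : set H) x :
  closure X x <-> forall e : R[i], 0 < e -> exists2 y, X y & `|x - y| <= e.
Proof.
split=> [cx e e0|h B].
  have [y [Xy]] := cx (ball x e) (nbhsx_ballx x e e0).
  by rewrite -ball_normE/= => /ltW xy; exists y.
move=> /nbhs_ballP[e /= e0 eB]; have e2 : 0 < e / 2 by rewrite divr_gt0.
have [y Xy xy] := h _ e2; exists y; split=> //; apply: eB; rewrite -ball_normE/=.
by apply: le_lt_trans xy _; rewrite ltr_pdivrMr// ltr_pMr// ltr1n.
Qed.

Lemma closure_subspace H (X : set H) : subspace_set X -> subspace_set (closure X).
Proof.
move=> [X0 XD]; split; first exact: subset_closure.
move=> a x y /closure_dist cx /closure_dist cy; apply/closure_dist => e e0.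
have a1 : 0 < `|a| + 1 by rewrite ltr_wpDl.
have d0 : 0 < e / 2 / (`|a| + 1) by rewrite !divr_gt0.
have e2 : 0 < e / 2 by rewrite divr_gt0.
have [x' Xx' xx'] := cx _ d0; have [y' Xy' yy'] := cy _ e2.
exists (a *: x' + y'); first exact: XD.
rewrite opprD addrACA -scalerBr (le_trans (ler_normD _ _))//.
rewrite [leRHS]splitr lerD// normrZ (le_trans (ler_wpM2l _ xx'))//.
by rewrite mulrCA ler_piMr ?ltW// ltr_pdivrMr// mul1r ltr_pwDr.
Qed.

(** The difference of a vector and its projection on the closed span is orthogonal
    to [X], hence zero. *)
Lemma dense_of_ortho H (X : set H) :
    (forall z, (forall x, X x -> inner x z = 0) -> z = 0) ->
  forall z e, 0 < e -> exists2 y, linear_span X y & `|z - y| <= e.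
Proof.
move=> Xz z; apply/closure_dist.
pose D := closure (linear_span X).
have Ds : subspace_set D by exact/closure_subspace/linear_span_subspace.
have [||||y Dy yP] := @riesz R H D (fun x => inner x z) `|z| Ds.
- exact: closed_closure.
- by move=> a x y; rewrite innerDl innerZl.
- exact: normr_ge0.
- by move=> x; rewrite mulrC; exact: inner_le.
suff -> : z = y by [].
apply/eqP; rewrite -subr_eq0; apply/eqP/Xz => x Xx.
rewrite innerBr yP ?subrr//; exact/subset_closure/sub_linear_span.
Qed.

Lemma closure_ortho H (X : set H) z : closure (linear_span X) = [set: H] ->
  (forall x, X x -> inner x z = 0) -> z = 0.
Proof.
move=> XT Xz; have : closure (linear_span X) z by rewrite XT.
move/closure_dist => cz; apply/eqP; rewrite -normr_le0.
apply/ler_addgt0Pl => e e0; rewrite addr0.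
have [y Xy zy] := cz _ e0.
have yz : inner y z = 0.
  apply: (@linear_span_min _ X [set y | inner y z = 0]) Xy => //.
  split=> /=; first by rewrite inner0l.
  by move=> a x x' xz x'z; rewrite innerDl innerZl xz x'z mulr0 addr0.
have [->|z0] := eqVneq z 0; first by rewrite normr0 ltW.
have nz : 0 < `|z| by rewrite normr_gt0.
rewrite -(ler_pM2r nz) -expr2 -inner_normE -[inner z z](subrK (inner y z)).
rewrite -innerBl yz addr0; apply: (@le_trans _ _ `|inner (z - y) z|).
  rewrite real_ler_norm// innerBl yz subr0 inner_normE.
  by rewrite rpredX ?normr_real.
by apply: le_trans (inner_le _ _) _; rewrite ler_wpM2r.
Qed.

End density.

(** * Newton-Schulz iteration in a TRO *)

Section newton_schulz.
Context {R : realType} {H K : hilbertType R}.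
Implicit Types (x c : bop H K) (M : set (bop H K)).

Lemma TRO_triple M x y z : TRO M -> M x -> M y -> M z ->
  M (bop_comp x (bop_comp (adj y) z)).
Proof.
move=> [_ MMM] Mx My Mz; apply: MMM.
exists (bop_comp x (adj y)); last by exists z => //; exact: bop_ext.
by exists x => //; exists (adj y) => //; apply/adjoint_setE; rewrite adjK.
Qed.

(** [1 - x^* x], which measures how far [x] is from an isometry. *)
Definition defect x (u : H) := u - adj x (x u).

Lemma defect_lin x a u v :
  defect x (a *: u + v) = a *: defect x u + defect x v.
Proof. by rewrite /defect (linearP x) (linearP (adj x)) scalerBr opprD addrACA. Qed.

Lemma defect_sym x u v : inner (defect x u) v = inner u (defect x v).
Proof. by rewrite innerBl innerBr -adjPr adjP. Qed.

Lemma inner_defect x u : inner (defect x u) u = `|u| ^+ 2 - `|x u| ^+ 2.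
Proof. by rewrite innerBl -adjPr !inner_normE. Qed.

Lemma defect_inner_ge0 x u : bounded_by x 1 -> 0 <= inner (defect x u) u.
Proof.
move=> x1; rewrite inner_defect subr_ge0 ler_sqr_ge0//.
by have := x1 u; rewrite mul1r.
Qed.

(** [|u - x^* x u|^2 = |u|^2 - 2 |x u|^2 + |x^* x u|^2], and the last term is at
    most [|x u|^2]. *)
Lemma defect_sq_le x u : bounded_by x 1 ->
  `|defect x u| ^+ 2 <= `|u| ^+ 2 - `|x u| ^+ 2.
Proof.
move=> x1; rewrite -inner_normE innerBr inner_defect gerBl.
rewrite innerBl -(adjP x u) !inner_normE subr_ge0 ler_sqr_ge0//.
by have := adj_bounded ler01 x1 (x u); rewrite mul1r.
Qed.

Lemma defect_le x u : bounded_by x 1 -> `|defect x u| <= `|u|.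
Proof.
move=> x1; rewrite -ler_sqr_ge0//; apply: le_trans (defect_sq_le _ x1) _.
by rewrite gerBl exprn_ge0.
Qed.

(** One step of the Newton-Schulz iteration for the polar part of [x].  Its terms
    are ternary products, so it stays in a TRO. *)
Definition newton_step x :=
  (3 / 2) *: x - (1 / 2) *: bop_comp x (bop_comp (adj x) x).

Lemma newton_stepE x u :
  newton_step x u = (3 / 2) *: x u - (1 / 2) *: x (adj x (x u)).
Proof. by []. Qed.

Lemma adj_newton_step x v : adj (newton_step x) v =
  (3 / 2) *: adj x v - (1 / 2) *: adj x (x (adj x v)).
Proof.
have half (n : nat) : (n%:R / 2 : R[i])^* = n%:R / 2.
  by rewrite conj_Creal// rpred_div// realn.
apply: inner_ext => u; rewrite -adjP newton_stepE innerBl innerBr !innerZl !innerZr.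
by rewrite (half 3) (half 1) !adjP adjK.
Qed.

(** With [e = 1 - x^* x], the new defect is [1 - (1 - e) (1 + e/2)^2]. *)
Lemma defect_newton_step x u : defect (newton_step x) u =
  (3 / 4) *: defect x (defect x u) +
  (1 / 4) *: defect x (defect x (defect x u)).
Proof.
apply: inner_extl => v.
have xB y w : x (y - w) = x y - x w by exact: linearB.
have aB y w : adj x (y - w) = adj x y - adj x w by exact: linearB.
have xZ a y : x (a *: y) = a *: x y by exact: linearZ.
have aZ a y : adj x (a *: y) = a *: adj x y by exact: linearZ.
rewrite /defect adj_newton_step newton_stepE !(xB, aB, xZ, aZ).
by rewrite !(innerBl, innerDl, innerZl); field.
Qed.

(** The new defect [3/4 e^2 + 1/4 e^3] is positive when [e] is. *)
Lemma newton_step_contraction x : bounded_by x 1 -> bounded_by (newton_step x) 1.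
Proof.
move=> x1 u; rewrite mul1r -ler_sqr_ge0// -subr_ge0 -inner_defect.
rewrite defect_newton_step innerDl !innerZl.
rewrite defect_sym inner_normE defect_sym.
by rewrite addr_ge0// mulr_ge0 ?divr_ge0 ?exprn_ge0// defect_inner_ge0.
Qed.

Lemma TRO_newton_step M x : TRO M -> M x -> M (newton_step x).
Proof.
move=> MT Mx; have [[M0 MD] _] := MT.
rewrite /newton_step addrC -scaleNr; apply: (MD); first exact: TRO_triple.
by rewrite -[_ *: _]addr0; exact: MD.
Qed.

(** Each step at least squares the defect, because [3/4 e^2 + 1/4 e^3] is [e^2]
    times a contraction.  The commutation of the defects of [x] and [c] is what
    makes the induction go through. *)
Lemma newton_iter M c k : TRO M -> M c -> bounded_by c 1 ->
  exists x, [/\ M x, bounded_by x 1,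
    forall u, defect x (defect c u) = defect c (defect x u) &
    forall u, `|defect x u| <= `|iter (2 ^ k) (defect c) u|].
Proof.
move=> MT Mc c1; elim: k => [|k [x [Mx x1 xc xk]]]; first by exists c.
exists (newton_step x); split.
- exact: TRO_newton_step.
- exact: newton_step_contraction.
- move=> u; rewrite !defect_newton_step.
  have e (v : H) : (1 / 4 : R[i]) *: v = (1 / 4) *: v + 0 by rewrite addr0.
  have d0 : defect c 0 = 0 by rewrite /defect (linear0 c) (linear0 (adj c)) subr0.
  by rewrite defect_lin [in RHS]e defect_lin d0 addr0 !xc.
- move=> u; rewrite defect_newton_step.
  set v := defect x (defect x u).
  apply: (@le_trans _ _ `|v|).
    apply: le_trans (ler_normD _ _) _; rewrite !normrZ.
    rewrite !ger0_norm ?divr_ge0//.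
    rewrite [leRHS](_ : _ = 3 / 4 * `|v| + 1 / 4 * `|v|); last by field.
    by rewrite lerD2l ler_wpM2l ?divr_ge0// defect_le.
  have commN n w : defect x (iter n (defect c) w) = iter n (defect c) (defect x w).
    by elim: n => //= n <-; rewrite xc.
  apply: le_trans (xk _) _; rewrite -commN.
  by apply: le_trans (xk _) _; rewrite -iterD addnn -mul2n expnS.
Qed.

End newton_schulz.

Section tro_approximation.
Context {R : realType} {H K : hilbertType R}.
Implicit Types (x c : bop H K) (M : set (bop H K)).

(** Let [d] be the defect of [c^*], and [w_m = d^m v].  The iterate on the left is
    [c^* w_n].  The estimate [|c^* w_m|^2 <= |w_m|^2 - |w_(m+1)|^2]
    ([defect_sq_le]) telescopes, and the numbers [|c^* w_m|] decrease, so the last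
    of them is the smallest. *)
Lemma defect_iter_le c v n : bounded_by c 1 ->
  n%:R * `|iter n (defect c) (adj c v)| ^+ 2 <= `|v| ^+ 2.
Proof.
move=> c1; have a1 : bounded_by (adj c) 1 := adj_bounded ler01 c1.
have twine w : adj c (defect (adj c) w) = defect c (adj c w).
  by rewrite /defect adjK linearB.
have twineN m w : adj c (iter m (defect (adj c)) w) = iter m (defect c) (adj c w).
  by elim: m => //= m <-; rewrite twine.
suff h m : m%:R * `|adj c (iter m (defect (adj c)) v)| ^+ 2 <=
    `|v| ^+ 2 - `|iter m (defect (adj c)) v| ^+ 2.
  by rewrite -twineN (le_trans (h n))// gerBl exprn_ge0.
elim: m => [|m IH]; first by rewrite mul0r subrr.
rewrite /= twine -natr1 mulrDl mul1r.
set w := iter m _ v in IH *.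
apply: (@le_trans _ _ (m%:R * `|adj c w| ^+ 2 + `|adj c w| ^+ 2)).
  have de : `|defect c (adj c w)| ^+ 2 <= `|adj c w| ^+ 2.
    by rewrite ler_sqr_ge0// defect_le.
  by rewrite lerD// ler_wpM2l.
have := lerD IH (defect_sq_le w a1); rewrite -subr_ge0 => h; rewrite -subr_ge0.
by apply: le_trans h _; rewrite le_eqVlt; apply/orP; left; apply/eqP; ring.
Qed.

Lemma natr_bound (b : R[i]) : b \is Num.real -> exists n, b <= n%:R.
Proof.
move=> br; exists (Num.bound `|complex.Re b|).
rewrite -(RRe_real br) -(rmorph_nat (real_complex R)) lecR.
by apply: ltW; apply: le_lt_trans (ler_norm _) (archi_boundP (normr_ge0 _)).
Qed.

Lemma seq_natr_bound (T : eqType) (s : seq T) (f : T -> R[i]) :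
  (forall t, f t \is Num.real) -> exists n : nat, forall t, t \in s -> f t <= n%:R.
Proof.
move=> fr; elim: s => [|t s [n IH]]; first by exists 0%N.
have [m mP] := natr_bound (fr t); exists (maxn m n) => u; rewrite inE => /predU1P[->|us].
  by rewrite (le_trans mP)// ler_nat leq_maxl.
by rewrite (le_trans (IH _ us))// ler_nat leq_maxr.
Qed.

(** Vectors in the range of [c^*] are almost fixed by [x^* x] for a late
    Newton-Schulz iterate [x] of [c], and this passes to vectors close to that range. *)
Lemma tro_approximation M (s : seq H) : TRO M ->
    (forall e : R[i], 0 < e -> exists2 c, M c &
       forall u, u \in s -> exists v, `|u - adj c v| <= e) ->
  forall e : R[i], 0 < e -> exists x, [/\ M x, bounded_by x 1 &
    forall u, u \in s -> `|defect x u| <= e].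
Proof.
move=> MT sM e e0; have e2 : 0 < e / 2 by rewrite divr_gt0.
have [c0 Mc0 c0s] := sM _ e2.
have [t t0 ct] := bop_bounded c0.
pose c := t^-1 *: c0.
have c1 : bounded_by c 1.
  move=> u; rewrite mul1r bopZE normrZ gtr0_norm ?invr_gt0//.
  by rewrite ler_pdivrMl.
have Mc : M c.
  by have [[M0 MD] _] := MT; rewrite /c -[_ *: _]addr0; exact: MD.
have cs u : exists v, u \in s -> `|u - adj c v| <= e / 2.
  have [us|us] := boolP (u \in s); last by exists 0.
  have [v uv] := c0s _ us; exists (t *: v) => _.
  have tr : (t^-1)^* = t^-1 by rewrite conj_Creal// rpredV gtr0_real.
  rewrite /c -[_ *: c0]addr0 adj_linear tr.
  have -> : adj (0 : bop H K) = 0.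
    by apply/esym/adj_unique => y z; rewrite inner0l inner0r.
  have aZ : adj c0 (t *: v) = t *: adj c0 v by exact: linearZ.
  by rewrite addr0 bopZE aZ scalerA mulVf ?gt_eqF// scale1r.
have [v vP] := choice cs.
have fr u : `|v u| ^+ 2 / (e / 2) ^+ 2 \is Num.real.
  by rewrite rpred_div// rpredX ?normr_real// gtr0_real.
have [n nP] := seq_natr_bound s fr.
have [x [Mx x1 _ xP]] := newton_iter n MT Mc c1.
exists x; split=> // u us.
have -> : defect x u = defect x (u - adj c (v u)) + defect x (adj c (v u)).
  by rewrite -[defect x (u - _)]scale1r -defect_lin scale1r subrK.
apply: le_trans (ler_normD _ _) _; rewrite [leRHS]splitr; apply: lerD.
  exact: le_trans (defect_le _ x1) (vP _ us).
apply: le_trans (xP _) _.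
rewrite -ler_sqr_ge0 ?(ltW e2)//.
have N0 : 0 < (2 ^ n)%:R :> R[i] by rewrite ltr0n expn_gt0.
rewrite -(ler_pM2l N0); apply: le_trans (defect_iter_le _ _ c1) _.
rewrite -ler_pdivrMr ?exprn_gt0//; apply: le_trans (nP _ us) _.
by rewrite ler_nat ltnW// ltn_expl.
Qed.

End tro_approximation.

(** * Coordinates in a Hilbert space direct sum and matrix entries *)

Section unconditional_sums.
Context {R : realType} {I : choiceType}.

Lemma partial_sumE (V : zmodType) (z : I -> V) (J : {fset I}) :
  summability.partial_sum z J = \sum_(i <- J) z i.
Proof. by rewrite /summability.partial_sum big_seq_fsetE. Qed.

Lemma cvg_totallyP (V : normedModType R[i]) (f : {fset I} -> V) (l : V) :
  f @ summability.totally --> l <->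
  forall e : R[i], 0 < e -> exists J : {fset I},
    forall J', (J `<=` J')%fset -> `|l - f J'| <= e.
Proof.
split=> [/cvgrPdist_le h e /h [J _ JP]|h]; first by exists J.
by apply/cvgrPdist_le => /= e /h [J JP]; exists J.
Qed.

Lemma partial_sum_single (V : normedModType R[i]) (z : I -> V) i :
  (forall j, j != i -> z j = 0) ->
  summability.partial_sum z @ summability.totally --> z i.
Proof.
move=> z0; apply/cvg_totallyP => e e0; exists [fset i]%fset => J.
rewrite fsub1set => iJ; rewrite partial_sumE (big_rem i)//= big_seq big1.
  by rewrite addr0 subrr normr0 ltW.
by move=> j; rewrite mem_rem_uniq ?fset_uniq// inE => /andP[/z0].
Qed.

End unconditional_sums.

Section direct_sum.
Context {R : realType} {I : choiceType}.
Implicit Types (H K : hilbertType R) (i j : I).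

Lemma hilbert_sum_single_subproof H i (x : H) :
  (fun j => if j == i then x else 0) \in @square_summable R I H.
Proof.
apply/asboolP; exists (`|x| ^+ 2) => J.
have [iJ|iJ] := boolP (i \in J).
  rewrite (big_rem i)//= eqxx big_seq big1 ?addr0//.
  move=> j; rewrite mem_rem_uniq ?fset_uniq// inE => /andP[/negbTE -> _].
  by rewrite normr0 expr0n.
rewrite big_seq big1 ?exprn_ge0// => j jJ; case: eqP => [ji|_].
  by rewrite -ji jJ in iJ.
by rewrite normr0 expr0n.
Qed.

Definition hilbert_sum_single H i (x : H) : hilbert_sum I H :=
  HilbertSum (hilbert_sum_single_subproof i x).

Lemma inner_single H i (x : H) (f : hilbert_sum I H) :
  inner (hilbert_sum_single i x) f = inner x (f i).
Proof.
apply: csum_lim.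
have := @partial_sum_single R I R[i]^o
   (fun j => inner (hilbert_sum_single i x j) (f j)) i.
rewrite /= eqxx; apply => j /negbTE ->; exact: inner0l.
Qed.

Lemma emb_exists H i : exists T : bop H (hilbert_sum I H),
  T =1 hilbert_sum_single i.
Proof.
apply: (@bop_exists R _ _ _ 1) => //.
  move=> a x y; apply: inner_extl => f.
  by rewrite innerDl innerZl !inner_single innerDl innerZl.
move=> x; rewrite mul1r -ler_sqr_ge0// -!inner_normE inner_single/=.
by rewrite eqxx.
Qed.

Definition emb H i : bop H (hilbert_sum I H) := projT1 (cid (emb_exists H i)).

Lemma embE H i (x : H) j : emb H i x j = if j == i then x else 0.
Proof. by rewrite /emb; case: cid => /= T ->. Qed.

Lemma inner_emb H i (x : H) f : inner (emb H i x) f = inner x (f i).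
Proof. by rewrite /emb; case: cid => /= T ->; exact: inner_single. Qed.

(** The coordinate map, obtained as an adjoint so that it is an operator at once. *)
Definition coord H i : bop (hilbert_sum I H) H := adj (emb H i).

Lemma coordE H i (f : hilbert_sum I H) : coord H i f = f i.
Proof. by apply: inner_ext => x; rewrite -adjP inner_emb. Qed.

Lemma coord_emb H i j (x : H) :
  coord H i (emb H j x) = if i == j then x else 0.
Proof. by rewrite coordE embE. Qed.

Lemma norm_emb H i (x : H) : `|emb H i x| = `|x|.
Proof.
apply/eqP; rewrite -(@eqrXn2 _ 2)// -!inner_normE inner_emb embE.
by rewrite eqxx.
Qed.

Lemma emb_bounded H i : bounded_by (emb H i) 1.
Proof. by move=> x; rewrite norm_emb mul1r. Qed.

Lemma coord_bounded H i : bounded_by (coord H i) 1.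
Proof. exact: adj_bounded ler01 (@emb_bounded H i). Qed.

Lemma hilbert_sum_ext H (f g : hilbert_sum I H) : (forall i, f i = g i) -> f = g.
Proof. by move=> fg; apply/val_inj/funext. Qed.

Lemma coord_sum_emb H (J : {fset I}) (x : I -> H) i :
  coord H i (\sum_(j <- J) emb H j (x j)) = if i \in J then x i else 0.
Proof.
rewrite linear_sum/=; case: ifPn => iJ.
  rewrite (big_rem i)//= coord_emb eqxx big_seq big1 ?addr0//.
  move=> j; rewrite mem_rem_uniq ?fset_uniq// inE => /andP[ji _].
  by rewrite coord_emb eq_sym (negbTE ji).
rewrite big_seq big1// => j jJ; rewrite coord_emb; case: eqP => // ij.
by rewrite ij jJ in iJ.
Qed.

Lemma norm_sum_emb H (J : {fset I}) (x : I -> H) :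
  `|\sum_(j <- J) emb H j (x j)| ^+ 2 = \sum_(j <- J) `|x j| ^+ 2.
Proof.
rewrite -inner_normE inner_suml big_seq [RHS]big_seq; apply: eq_bigr => j jJ.
by rewrite inner_emb -coordE coord_sum_emb jJ inner_normE.
Qed.

(** The squared norm of the remainder is a tail of the series for [|f|^2]. *)
Lemma sum_emb_cvg H (f : hilbert_sum I H) :
  (fun J : {fset I} => \sum_(j <- J) emb H j (f j)) @ summability.totally --> f.
Proof.
apply/cvg_totallyP => e e0.
have /cvg_totallyP : csummable (fun i => inner (f i) (f i)).
  exact: hilbert_sum_summable.
move=> /(_ (e ^+ 2)); rewrite exprn_gt0// => /(_ isT)[J JP].
exists J => J' /JP; rewrite psum_fset => h.
rewrite -ler_sqr_ge0 ?(ltW e0)//; apply: le_trans h.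
rewrite (_ : csum _ = `|f| ^+ 2); last by rewrite -inner_normE.
have fJ : inner f (\sum_(j <- J') emb H j (f j)) = \sum_(j <- J') inner (f j) (f j).
  rewrite inner_sumr; apply: eq_bigr => j _.
  by rewrite innerC inner_emb -innerC.
rewrite -inner_normE innerBr !innerBl (innerC f (\sum_(j <- J') _)) fJ.
rewrite !inner_normE norm_sum_emb.
have sr : \sum_(j <- J') inner (f j) (f j) = \sum_(j <- J') `|f j| ^+ 2.
  by apply: eq_bigr => j _; rewrite inner_normE.
have sumr : \sum_(j <- J') `|f j| ^+ 2 \is Num.real.
  by rewrite rpred_sum// => *; rewrite rpredX ?normr_real.
rewrite sr conj_Creal ?subrr ?subr0// real_ler_norm// rpredB//.
by rewrite rpredX ?normr_real.
Qed.

Definition entry H K (T : bop (hilbert_sum I H) (hilbert_sum I K)) i j :=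
  bop_comp (coord K i) (bop_comp T (emb H j)).

(** Every bounded operator on a direct sum is given by its matrix of entries, and
    this matrix has uniformly bounded finite submatrices.  So membership in
    [matrix_space] is a condition on the entries only. *)
Lemma matrix_spaceE H K (X : set (bop H K)) T :
  matrix_space I X T <-> forall i j, X (entry T i j).
Proof.
split=> [[A [XA _ AT]] i j|XT].
  rewrite (_ : entry _ _ _ = A i j)//; apply: bop_ext => y /=.
  have c1 : summability.partial_sum (fun k => A i k (emb H j y k))
      @ summability.totally --> A i j y.
    have := @partial_sum_single R I K (fun k => A i k (emb H j y k)) j.
    rewrite embE eqxx; apply=> k /negbTE kj; rewrite embE kj; exact: linear0.
  rewrite coordE; apply: cvg_unique (AT (emb H j y) i) c1.
  exact: norm_hausdorff.
exists (entry T); split=> //.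
  have [c c0 cT] := bop_bounded T.
  exists c; first exact: ltW.
  move=> J L x; rewrite -(norm_sum_emb L x) -exprMn.
  apply: (@le_trans _ _ (`|T (\sum_(j <- L) emb H j (x j))| ^+ 2)); last first.
    by rewrite ler_sqr_ge0// mulr_ge0// ltW.
  rewrite -inner_normE; apply: le_trans (hilbert_sum_inner_ge _ J).
  apply: ler_sum => i _; rewrite linear_sum -coordE linear_sum/= le_eqVlt.
  by apply/orP; left.
move=> x i; have := @sum_emb_cvg H x.
move/(continuous_cvg _ (@bop_continuous _ _ _ T x)).
move/(continuous_cvg _ (@bop_continuous _ _ _ (coord K i) (T x))).
rewrite coordE; apply: cvg_trans; apply: near_eq_cvg; near=> J.
by rewrite /= partial_sumE !linear_sum.
Unshelve. all: by end_near. Qed.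

Lemma entry_linear H K a (T S : bop (hilbert_sum I H) (hilbert_sum I K)) i j :
  entry (a *: T + S) i j = a *: entry T i j + entry S i j.
Proof. by apply: bop_ext => x /=; rewrite linearP. Qed.

Lemma matrix_space_subspace H K (X : set (bop H K)) :
  subspace_set X -> subspace_set (matrix_space I X).
Proof.
move=> [X0 XD]; split=> [|a S T /matrix_spaceE XS /matrix_spaceE XT];
  apply/matrix_spaceE => i j; last by rewrite entry_linear; exact: XD.
by rewrite (_ : entry 0 i j = 0)//; apply: bop_ext => x /=; rewrite linear0.
Qed.

End direct_sum.

(** * Ultrafilter limits and the weak* topology *)

Section filters.
Context {R : realType}.

Lemma cvg_initial (S : choiceType) (T : topologicalType) (f : S -> T)
    (F : set_system S) (s : S) : Filter F ->
  f @ F --> f s -> F --> (s : initial_topology f).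
Proof.
move=> FF fs A /= [_ [[B Bop <-] Bfs sBfA]].
by apply: filterS sBfA _; apply: fs; exact: open_nbhs_nbhs.
Qed.

Lemma cvg_weakstar (H K : hilbertType R) (F : set_system (bop H K))
    (T : bop H K) : Filter F ->
    (forall p, normal_eval S p @[S --> F] --> normal_eval T p) ->
  F --> (T : weakstar H K).
Proof.
move=> FF h; apply: cvg_initial; apply/cvg_sup => p.
exact: (@cvg_initial _ _ (fun g : _ -> R[i]^o => g p) (@normal_eval R H K @ F)
  (@normal_eval R H K T) _ (h p)).
Qed.

Lemma ultra_fmap (S T : Type) (F : set_system S) (f : S -> T) :
  UltraFilter F -> UltraFilter (f @ F).
Proof.
move=> FU; split; first exact: fmap_proper_filter.
move=> G GF FG; apply/seteqP; split=> // A GA.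
have [//|nA] := in_ultra_setVsetC (f @^-1` A) FU.
have GnA : G (~` A) by exact: FG.
by have [t []] := filter_ex (filterI GA GnA).
Qed.

Lemma ultra_bounded_cvg_real (T : Type) (F : set_system T) (f : T -> R) (M : R) :
  UltraFilter F -> F [set t | `|f t| <= M] -> exists l : R, f @ F --> l.
Proof.
move=> FU FM; have := @segment_compact R (- M) M.
rewrite compact_ultra => /(_ (f @ F) (ultra_fmap f FU))[|l [_ lP]]; last by exists l.
suff : F (f @^-1` [set` `[- M, M]]) by [].
by apply: filterS FM => t /=; rewrite in_itv/= ler_norml.
Qed.

(** Compactness of segments, applied to real and imaginary parts. *)
Lemma ultra_bounded_cvg (T : Type) (F : set_system T) (f : T -> R[i]) (M : R[i]) :
  UltraFilter F -> F [set t | `|f t| <= M] -> exists l : R[i], f @ F --> (l : R[i]^o).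
Proof.
move=> FU FM; have FF : Filter F by exact: filter_filter.
have le_part (z : R[i]) : `|z| <= M ->
    `|complex.Re z| <= complex.Re M /\ `|complex.Im z| <= complex.Re M.
  move=> zM; have M0 : 0 <= M := le_trans (normr_ge0 _) zM.
  have ME : ((complex.Re M)%:C)%C = M by apply: RRe_real; exact: ger0_real.
  split; rewrite -lecR ME (le_trans _ zM)// ?normc_ge_Re//.
  case: z {zM} => x y; rewrite normc_def/= lecR -(sqrtr_sqr y).
  by rewrite ler_wsqrtr// lerDr sqr_ge0.
have [a aP] : exists l : R, (fun t => complex.Re (f t)) @ F --> l.
  apply: (@ultra_bounded_cvg_real _ _ _ (complex.Re M)).
  by apply: filterS FM => t /le_part[].
have [b bP] : exists l : R, (fun t => complex.Im (f t)) @ F --> l.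
  apply: (@ultra_bounded_cvg_real _ _ _ (complex.Re M)).
  by apply: filterS FM => t /le_part[].
exists (a +i* b)%C; apply/(@cvgrPdist_le R[i] R[i]^o) => e e0.
have eE : ((complex.Re e)%:C)%C = e by apply: RRe_real; exact: gtr0_real.
have e2 : 0 < complex.Re e / 2 by rewrite divr_gt0// -ltcR eE.
have /(@cvgrPdist_le R R^o)/(_ _ e2) ha := aP.
have /(@cvgrPdist_le R R^o)/(_ _ e2) hb := bP.
apply: filterS2 hb ha => t /= bt at_.
case: (f t) bt at_ => x y /= yb xa.
rewrite normc_def/= -eE lecR -[leRHS]ger0_norm; last first.
  by rewrite -lecR eE ltW.
rewrite -(sqrtr_sqr (complex.Re e)) ler_wsqrtr//.
have h : (a - x) ^+ 2 <= (complex.Re e / 2) ^+ 2.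
  by rewrite -real_normK ?num_real// ler_pXn2r ?nnegrE// ltW.
have h' : (b - y) ^+ 2 <= (complex.Re e / 2) ^+ 2.
  by rewrite -real_normK ?num_real// ler_pXn2r ?nnegrE// ltW.
apply: le_trans (lerD h h') _.
rewrite -mulr2n -subr_ge0 (_ : _ - _ = (complex.Re e) ^+ 2 / 2); last by field.
by rewrite divr_ge0// sqr_ge0.
Qed.

End filters.

(** * Weak operator limits in matrix spaces *)

Section weak_operator_limits.
Context {R : realType}.
Implicit Types (H K : hilbertType R).

(** Convergence in the weak operator topology. *)
Definition wot_cvg H K (F : set_system (bop H K)) (T : bop H K) :=
  forall x y, (fun S : bop H K => inner (S x) y) @ F --> (inner (T x) y : R[i]^o).

Lemma ler_mul_eps (b c v : R[i]) : 0 <= c ->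
  (forall e, 0 < e -> v <= b + c * e) -> v <= b.
Proof.
move=> c0 h; apply/ler_addgt0Pr => e e0.
have c1 : 0 < c + 1 by rewrite ltr_wpDl.
apply: le_trans (h _ (divr_gt0 e0 c1)) _.
by rewrite lerD2l mulrCA ler_piMr ?(ltW e0)// ler_pdivrMr// mul1r lerDl.
Qed.

Lemma inner_bounded H K (T : bop H K) c : 0 <= c ->
  (forall x y, `|inner (T x) y| <= c * `|x| * `|y|) -> bounded_by T c.
Proof.
move=> c0 Tc x; have [->|nz] := eqVneq (T x) 0.
  by rewrite normr0 mulr_ge0.
have {}nz : 0 < `|T x| by rewrite normr_gt0.
rewrite -(ler_pM2r nz) -expr2 -inner_normE; apply: le_trans (Tc _ _).
by rewrite real_ler_norm// inner_normE rpredX ?normr_real.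
Qed.

Lemma cvg_norm_le (T : Type) (F : set_system T) (f : T -> R[i]) (l b : R[i]) :
    ProperFilter F -> 0 <= b ->
    f @ F --> (l : R[i]^o) -> F [set t | `|f t| <= b] -> `|l| <= b.
Proof.
move=> FF b0 fl Fb; apply/ler_addgt0Pr => e e0.
have /(@cvgrPdist_le R[i] R[i]^o)/(_ _ e0) fe := fl.
have [t [/= ft lt]] := filter_ex (filterI Fb fe).
by rewrite -(subrK (f t) l) addrC (le_trans (ler_normD _ _))// lerD.
Qed.

(** The pointwise limit of the forms [inner (S x) y] is a bounded sesquilinear form.
    This is the compactness of balls in the weak operator topology. *)
Lemma wot_limit H K (F : set_system (bop H K)) c : UltraFilter F -> 0 <= c ->
    F [set S : bop H K | bounded_by S c] ->
  exists2 T : bop H K, bounded_by T c & wot_cvg F T.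
Proof.
move=> FU c0 Fc; have FF : ProperFilter F by exact: ultra_proper.
have Fb x y : F [set S : bop H K | `|inner (S x) y| <= c * `|x| * `|y|].
  by apply: filterS Fc => S Sc; exact: bounded_by_inner.
have l_ex x : exists lx, forall y,
    (fun S : bop H K => inner (S x) y) @ F --> (lx y : R[i]^o).
  have h y : exists l : R[i], (fun S : bop H K => inner (S x) y) @ F --> (l : R[i]^o).
    exact: ultra_bounded_cvg (Fb x y).
  by have [lx lxP] := choice h; exists lx.
have [l lP] := choice l_ex.
have l_unique x y (z : R[i]) :
    (fun S : bop H K => inner (S x) y) @ F --> (z : R[i]^o) -> l x y = z.
  by move=> h; apply: (cvg_unique _ (lP x y) h); exact: norm_hausdorff.
have [|||T Tl Tc] := @sesquilinear_bop R H K l c c0.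
- move=> a x x' y; apply: l_unique.
  rewrite (_ : (fun S : bop H K => _) = fun S =>
    a *: (inner (S x) y : R[i]^o) + (inner (S x') y : R[i]^o)); last first.
    by apply/funext => S; rewrite linearP innerDl innerZl.
  by apply: cvgD; [apply: cvgZr|]; exact: lP.
- move=> a x y y'; apply: l_unique.
  rewrite (_ : (fun S : bop H K => _) = fun S =>
    a^* *: (inner (S x) y : R[i]^o) + (inner (S x) y' : R[i]^o)); last first.
    by apply/funext => S; rewrite innerDr innerZr.
  by apply: cvgD; [apply: cvgZr|]; exact: lP.
- move=> x y; apply: cvg_norm_le (lP x y) (Fb x y).
  by rewrite !mulr_ge0.
exists T; first exact: Tc.
by move=> x y; rewrite Tl; exact: lP.
Qed.

Lemma csum_tail (I : choiceType) (z u : I -> R[i]) (c M : R[i]) (J : {fset I}) :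
    0 <= c -> (forall i, 0 <= u i) -> (forall i, `|z i| <= c * u i) ->
    (forall J : {fset I}, \sum_(i <- J) u i <= M) ->
  `|csum z - \sum_(i <- J) z i| <= c * (csum u - \sum_(i <- J) u i).
Proof.
move=> c0 u0 zu uM.
have uM' L : summability.partial_sum (u : I -> R[i]^o) L <= M by rewrite psum_fset.
have uJ (L : {fset I}) : \sum_(i <- L) u i <= csum u.
  by have := csum_ge u0 uM' L; rewrite psum_fset.
have zc : csummable z.
  apply: csum_cvg; apply: (@abs_summable_le _ _ _ (fun i => c * u i) (c * M) zu) => L.
  by rewrite psum_fset -mulr_sumr ler_wpM2l.
apply/ler_addgt0Pr => e e0.
have /cvg_totallyP/(_ _ e0)[L LP] := zc.
have := LP (L `|` J)%fset; rewrite fsubsetUl psum_fset => /(_ isT).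
set L' := (L `|` J)%fset => h.
have JL' : (J `<=` L')%fset by exact: fsubsetUr.
have JE (f : I -> R[i]) :
    \sum_(i <- J) f i = \sum_(i <- L') if i \in J then f i else 0.
  rewrite big_seq (eq_bigr (fun i => if i \in J then f i else 0)); last by move=> i ->.
  rewrite -big_seq; apply: big_fset_incl => // i _ /negbTE ->//.
have -> : csum z - \sum_(i <- J) z i =
    (\sum_(i <- L') z i - \sum_(i <- J) z i) + (csum z - \sum_(i <- L') z i) by ring.
apply: le_trans (ler_normD _ _) _; apply: lerD => //.
apply: (@le_trans _ _ (c * (\sum_(i <- L') u i - \sum_(i <- J) u i))); last first.
  by rewrite ler_wpM2l// lerB.
rewrite !JE -!sumrB mulr_sumr; apply: le_trans (ler_norm_sum _ _ _) _.
apply: ler_sum => i _; case: ifP => _; first by rewrite !subrr normr0 mulr0.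
by rewrite !subr0.
Qed.

(** A weak* continuous functional [normal_eval] is a series whose terms are weakly
    continuous.  On a ball its tails are uniformly small, being dominated by the
    tails of the square summable sequences in [p]. *)
Lemma wot_cvg_normal_eval H K (F : set_system (bop H K)) (T : bop H K) c p :
    ProperFilter F -> 0 <= c -> F [set S : bop H K | bounded_by S c] -> bounded_by T c ->
    wot_cvg F T ->
  normal_eval S p @[S --> F] --> normal_eval T p.
Proof.
move=> FF c0 Fc Tc FT; case: p => x y.
have [M xM] := hilbert_sum_bound x; have [N yN] := hilbert_sum_bound y.
pose u n : R[i] := `|x n| ^+ 2 + `|y n| ^+ 2.
have u0 n : 0 <= u n by rewrite addr_ge0// exprn_ge0.
have uM (J : {fset nat}) : \sum_(n <- J) u n <= M + N.
  by rewrite big_split/= lerD// -psum_fset.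
have uc : csummable u.
  apply: csum_cvg; apply: (@abs_summable_le _ _ _ u (M + N)) => J.
    by rewrite ger0_norm.
  by rewrite psum_fset.
have tail (S : bop H K) (J : {fset nat}) : bounded_by S c ->
    `|normal_eval S (x, y) - \sum_(n <- J) inner (S (x n)) (y n)| <=
    c * (csum u - \sum_(n <- J) u n).
  move=> Sc; apply: (csum_tail (M := M + N)) => // n.
  apply: le_trans (bounded_by_inner _ _ Sc) _; rewrite -mulrA ler_wpM2l//.
  rewrite -subr_ge0 (_ : _ - _ = ((`|x n| - `|y n|) ^+ 2 + `|x n| ^+ 2
    + `|y n| ^+ 2) / 2); last by rewrite /u; field.
  have sq0 : 0 <= (`|x n| - `|y n|) ^+ 2.
    by rewrite real_exprn_even_ge0// rpredB ?normr_real.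
  by rewrite divr_ge0// (addr_ge0 (addr_ge0 sq0 _))// exprn_ge0.
have sum_cvg (s : seq nat) :
    (fun S : bop H K => \sum_(n <- s) inner (S (x n)) (y n)) @ F -->
      (\sum_(n <- s) inner (T (x n)) (y n) : R[i]^o).
  elim: s => [|n s IH].
    rewrite big_nil (_ : (fun S : bop H K => _) = fun=> 0); first exact: cvg_cst.
    by apply/funext => S; rewrite big_nil.
  rewrite big_cons (_ : (fun S : bop H K => _) = fun S =>
    (inner (S (x n)) (y n) : R[i]^o) + (\sum_(n <- s) inner (S (x n)) (y n) : R[i]^o)).
    exact: (@cvgD _ R[i]^o _ _ _ _ _ _ _ (FT (x n) (y n)) IH).
  by apply/funext => S; rewrite big_cons.
apply/(@cvgrPdist_le R[i] R[i]^o) => e e0.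
have d0 : 0 < e / 3 / (c + 1) by rewrite !divr_gt0// ltr_wpDl.
have /cvg_totallyP/(_ _ d0)[J /(_ J (fsubset_refl _))] := uc.
rewrite psum_fset => /(le_trans (real_ler_norm _)) uJ.
have {}uJ : c * (csum u - \sum_(n <- J) u n) <= e / 3.
  apply: (@le_trans _ _ (c * (e / 3 / (c + 1)))).
    have uM' J' : summability.partial_sum (u : nat -> R[i]^o) J' <= M + N.
      by rewrite psum_fset.
    have := csum_ge u0 uM' J; rewrite psum_fset => uJ'.
    by rewrite ler_wpM2l// uJ// ger0_real// subr_ge0.
  rewrite mulrCA ler_piMr ?divr_ge0 ?(ltW e0)//.
  by rewrite ler_pdivrMr ?ltr_wpDl// mul1r lerDl.
have e3 : 0 < e / 3 by rewrite divr_gt0.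
have /(@cvgrPdist_le R[i] R[i]^o)/(_ _ e3) near_sum := sum_cvg J.
apply: filterS2 Fc near_sum => S /= Sc ST.
rewrite (_ : _ - _ = (normal_eval T (x, y) - \sum_(n <- J) inner (T (x n)) (y n))
  + (\sum_(n <- J) inner (T (x n)) (y n) - \sum_(n <- J) inner (S (x n)) (y n))
  - (normal_eval S (x, y) - \sum_(n <- J) inner (S (x n)) (y n))); last by ring.
rewrite (_ : e = e / 3 + e / 3 + e / 3); last by field.
apply: le_trans (ler_normB _ _) _; apply: lerD.
  apply: le_trans (ler_normD _ _) _; apply: lerD => //.
  exact: le_trans (tail _ _ Tc) uJ.
exact: le_trans (tail _ _ Sc) uJ.
Qed.

Lemma weakstar_closed_wot H K (X : set (bop H K)) (F : set_system (bop H K))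
    (T : bop H K) c :
    weakstar_closed X -> ProperFilter F -> 0 <= c ->
    F [set S : bop H K | bounded_by S c] -> bounded_by T c ->
    wot_cvg F T -> F X -> X T.
Proof.
move=> Xc FF c0 Fc Tc FT FX; apply: Xc => B.
have /[apply] FB : F --> (T : weakstar H K).
  by apply: cvg_weakstar => p; exact: wot_cvg_normal_eval Fc Tc FT.
exact: filter_ex (filterI FX FB).
Qed.

Lemma matrix_space_wot (I : choiceType) H K (X : set (bop H K))
    (F : set_system (bop (hilbert_sum I H) (hilbert_sum I K)))
    (T : bop (hilbert_sum I H) (hilbert_sum I K)) c :
    weakstar_closed X -> ProperFilter F -> 0 <= c ->
    F [set S : bop (hilbert_sum I H) (hilbert_sum I K) | bounded_by S c] ->
    bounded_by T c -> wot_cvg F T -> F (matrix_space I X) -> matrix_space I X T.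
Proof.
move=> Xc FF c0 Fc Tc FT FX; apply/matrix_spaceE => i j.
have entry_bounded (S : bop (hilbert_sum I H) (hilbert_sum I K)) :
    bounded_by S c -> bounded_by (entry S i j) c.
  move=> Sc; rewrite -[c]mul1r -[1 * c]mulr1 -mulrA.
  apply: bounded_by_comp => //; first exact: coord_bounded.
  by apply: bounded_by_comp => //; exact: emb_bounded.
apply: (@weakstar_closed_wot _ _ _ ((fun S => entry S i j) @ F) _ c Xc) => //.
- suff : F [set S : bop _ _ | bounded_by (entry S i j) c] by [].
  by apply: filterS Fc => S /entry_bounded.
- exact: entry_bounded.
- move=> x y.
  have E (S : bop (hilbert_sum I H) (hilbert_sum I K)) :
      inner (entry S i j x) y = inner (S (emb H j x)) (emb K i y).
    by rewrite /= (adjP (coord K i)) adjK.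
  suff : (fun S => inner (entry S i j x) y) @ F --> (inner (entry T i j x) y : R[i]^o).
    by [].
  rewrite E (_ : (fun S => _) =
    fun S : bop _ _ => inner (S (emb H j x)) (emb K i y)); last exact/funext.
  exact: FT.
- suff : F [set S : bop _ _ | X (entry S i j)] by [].
  by apply: filterS FX => S /matrix_spaceE h; exact: h.
Qed.

(** The bounded part of the matrix space over a weak* closed space is compact for
    the weak operator topology, so an operator that is within [c] of it on
    finite sets of vectors, up to small errors, is within [c] of it.  The weight
    [(1 + |x|) (1 + |y|)] of the error absorbs constant, linear and bilinear
    error terms. *)
Lemma matrix_space_compactness (I : choiceType) H K (X : set (bop H K))
    (T : bop (hilbert_sum I H) (hilbert_sum I K)) b c :
    weakstar_closed X -> 0 <= b -> 0 <= c ->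
    (forall (s1 : seq (hilbert_sum I H)) (s2 : seq (hilbert_sum I K)) (e : R[i]),
      0 < e -> exists Y, [/\ matrix_space I X Y, bounded_by Y b &
        forall x y, x \in s1 -> y \in s2 -> `|inner ((T - Y) x) y| <=
          c * `|x| * `|y| + (1 + `|x|) * (1 + `|y|) * e]) ->
  exists2 Y, matrix_space I X Y & bounded_by (T - Y) c.
Proof.
move=> Xc b0 c0 approx.
pose A (p : seq (hilbert_sum I H) * seq (hilbert_sum I K) * R[i]) :=
  [set Y : bop (hilbert_sum I H) (hilbert_sum I K) |
    [/\ matrix_space I X Y, bounded_by Y b &
      forall x y, x \in p.1.1 -> y \in p.1.2 -> `|inner ((T - Y) x) y| <=
          c * `|x| * `|y| + (1 + `|x|) * (1 + `|y|) * p.2]].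
pose F := filter_from [set p | 0 < p.2] A.
have FF : ProperFilter F.
  apply: filter_from_proper; last first.
    by move=> [[s1 s2] e] /= e0; exact: approx.
  apply: filter_from_filter; first by exists ([::], [::], 1) => /=.
  move=> [[s1 s2] e] [[t1 t2] d] /= e0 d0.
  have [m [m0 [me md]]] : exists m : R[i], 0 < m /\ m <= e /\ m <= d.
    have /orP[ed|ed] := real_leVge (gtr0_real e0) (gtr0_real d0).
      by exists e.
    by exists d.
  exists (s1 ++ t1, s2 ++ t2, m) => //= Y [XY Yb YP].
  have w (x y : R[i]) : 0 <= (1 + `|x|) * (1 + `|y|) by rewrite mulr_ge0// addr_ge0.
  split; split => //= x y xs ys.
    apply: le_trans (YP x y _ _) _; rewrite ?mem_cat ?xs ?ys//.
    by rewrite lerD2l ler_wpM2l// mulr_ge0// addr_ge0.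
  apply: le_trans (YP x y _ _) _; rewrite ?mem_cat ?xs ?ys ?orbT//.
  by rewrite lerD2l ler_wpM2l// mulr_ge0// addr_ge0.
have [G [GU FG]] := ultraFilterLemma FF.
have GA p : 0 < p.2 -> G (A p) by move=> p0; apply: FG; exists p.
have G0 : G (A ([::], [::], 1)) by exact: GA.
have Gb : G [set S : bop _ _ | bounded_by S b] by apply: filterS G0 => S [].
have [Y Yb GY] := wot_limit GU b0 Gb.
exists Y.
  apply: matrix_space_wot Gb Yb GY _ => //.
  by apply: filterS G0 => S [].
apply: inner_bounded => // x y.
have w0 : 0 <= (1 + `|x|) * (1 + `|y|) by rewrite mulr_ge0// addr_ge0.
apply: (ler_mul_eps w0) => e e0.
apply: (@cvg_norm_le _ G (fun S => inner ((T - S) x) y)).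
- by rewrite addr_ge0 ?mulr_ge0// ?addr_ge0// ltW.
- rewrite (_ : (fun S => _) = fun S : bop _ _ =>
    (inner (T x) y : R[i]^o) - (inner (S x) y : R[i]^o)); last first.
    by apply/funext => S; rewrite bopBE innerBl.
  rewrite bopBE innerBl.
  exact: (@cvgB _ R[i]^o _ _ _ _ _ _ _ (cvg_cst _) (GY x y)).
- apply: filterS (GA ([:: x], [:: y], e) e0) => S [_ _]; apply; exact: mem_head.
Qed.

End weak_operator_limits.

(** * Finite matrices over a TRO *)

Section finite_matrices.
Context {R : realType} {I : choiceType}.
Implicit Types (G H K : hilbertType R).

(** The function [s] is the identity or the conjugation, so that linear and
    antilinear maps are treated together. *)
Lemma linear_span_image (V W : lmodType R[i]) (X : set V) (L : set W) (f : V -> W)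
    (s : R[i] -> R[i]) :
    subspace_set L -> s 1 = 1 ->
    (forall a x y, f (a *: x + y) = s a *: f x + f y) ->
    (forall x, X x -> L (f x)) -> forall x, linear_span X x -> L (f x).
Proof.
move=> [L0 LD] s1 fD fX x; apply: (@linear_span_min _ _ X [set x | L (f x)]) => //.
have f0 : f 0 = 0.
  have := fD 1 0 0; rewrite s1 !scale1r addr0 => /eqP.
  by rewrite -subr_eq0 opprD addrA subrr sub0r oppr_eq0 => /eqP.
by split=> [|a y z Ly Lz] /=; rewrite ?f0// fD; exact: LD.
Qed.

Lemma bop_comp_linearl G H K a (S S' : bop H K) (T : bop G H) :
  bop_comp (a *: S + S') T = a *: bop_comp S T + bop_comp S' T.
Proof. exact: bop_ext. Qed.

Lemma bop_comp_linearr G H K a (S : bop H K) (T T' : bop G H) :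
  bop_comp S (a *: T + T') = a *: bop_comp S T + bop_comp S T'.
Proof. by apply: bop_ext => x /=; exact: linearP. Qed.

Definition unit_matrix H K i j (m : bop H K) :
    bop (hilbert_sum I H) (hilbert_sum I K) :=
  bop_comp (emb K i) (bop_comp m (coord H j)).

Definition finite_matrices H K (M : set (bop H K)) :=
  linear_span [set T | exists i j m, M m /\ T = unit_matrix i j m].

Lemma unit_matrixE H K i j (m : bop H K) f :
  unit_matrix i j m f = emb K i (m (f j)).
Proof. by rewrite /= coordE. Qed.

Lemma adj_unit_matrix H K i j (m : bop H K) :
  adj (unit_matrix i j m) = unit_matrix j i (adj m).
Proof.
by rewrite !adj_comp adjK; apply: bop_ext.
Qed.

Lemma unit_matrix_finite H K (M : set (bop H K)) i j m :
  M m -> finite_matrices M (unit_matrix i j m).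
Proof. by move=> Mm; apply: sub_linear_span; exists i, j, m. Qed.

Lemma finite_matrices_subspace H K (M : set (bop H K)) :
  subspace_set (finite_matrices M).
Proof. exact: linear_span_subspace. Qed.

Lemma adj_finite_matrices H K (M : set (bop H K)) W :
  finite_matrices M W -> finite_matrices (adjoint_set M) (adj W).
Proof.
apply: (linear_span_image (s := Num.conj)); first exact: finite_matrices_subspace.
- exact: rmorph1.
- by move=> a x y; rewrite adj_linear.
move=> _ [i [j [m [Mm ->]]]]; rewrite adj_unit_matrix.
by apply: unit_matrix_finite; apply/adjoint_setE; rewrite adjK.
Qed.

(** The triple product is linear or antilinear in each variable, so it suffices to
    multiply matrices with one entry. *)
Lemma finite_matrices_TRO H K (M : set (bop H K)) :
  TRO M -> TRO (finite_matrices M).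
Proof.
move=> MT; split; first exact: finite_matrices_subspace.
move=> _ [_ [x Mx [y' /adjoint_setE + <-]] [z Mz <-]].
move: (adj y') (adjK y') => y <- {y'} My.
have L := finite_matrices_subspace M.
apply: (linear_span_image (f := fun x => bop_comp (bop_comp x (adj y)) z)
  (s := id) L _ _ _ Mx) => //.
  by move=> a x' x''; rewrite !bop_comp_linearl.
move=> {x Mx} _ [i [j [m [Mm ->]]]].
move: y My.
apply: (linear_span_image (s := Num.conj)
  (f := fun y => bop_comp (bop_comp (unit_matrix i j m) (adj y)) z) L).
- exact: rmorph1.
- by move=> a y y'; rewrite adj_linear bop_comp_linearr bop_comp_linearl.
move=> _ [k [l [n [Mn ->]]]].
move: z Mz.
apply: (linear_span_image (s := id) L) => //.
  by move=> a z z'; rewrite bop_comp_linearr.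
move=> _ [p [q [o [Mo ->]]]].
rewrite adj_unit_matrix.
have [jl|jl] := eqVneq j l; last first.
  rewrite (_ : bop_comp _ _ = 0); first by case: L.
  apply: bop_ext => f /=; rewrite coord_emb (negbTE jl).
  by rewrite !linear0.
have [kp|kp] := eqVneq k p; last first.
  rewrite (_ : bop_comp _ _ = 0); first by case: L.
  apply: bop_ext => f /=; rewrite (coord_emb k) (negbTE kp).
  by rewrite !linear0.
rewrite (_ : bop_comp _ _ = unit_matrix i q (bop_comp m (bop_comp (adj n) o))).
  by apply: unit_matrix_finite; exact: TRO_triple.
by apply: bop_ext => f /=; rewrite jl kp !coord_emb !eqxx.
Qed.

(** For matrices [W1], [W2] with one entry, the product has at most one nonzero
    entry, which is of the form [m v n^*]. *)
Lemma matrix_space_transfer H1 H2 K1 K2 (A2 : set (bop H2 K2)) (A1 : set (bop H1 K1))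
    (V : set (bop H1 H2)) (U : set (bop K1 K2)) W2 W1 Y :
    subspace_set U ->
    (forall m v n, A2 m -> V v -> A1 n -> U (bop_comp m (bop_comp v (adj n)))) ->
    finite_matrices A2 W2 -> finite_matrices A1 W1 -> matrix_space I V Y ->
  matrix_space I U (bop_comp W2 (bop_comp Y (adj W1))).
Proof.
move=> Us AVA W2A W1A /matrix_spaceE YV.
have L := @matrix_space_subspace R I _ _ _ Us.
apply: (linear_span_image (f := fun W => bop_comp W (bop_comp Y (adj W1)))
  (s := id) L _ _ _ W2A) => //.
  by move=> a y y'; rewrite bop_comp_linearl.
move=> {W2 W2A} _ [i [j [m [Am ->]]]].
move: W1 W1A; apply: (linear_span_image (s := Num.conj) L); first exact: rmorph1.
  by move=> a y y'; rewrite adj_linear !bop_comp_linearr.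
move=> _ [k [l [n [An ->]]]]; rewrite adj_unit_matrix.
apply/matrix_spaceE => p q.
have U0 : U 0 by case: Us.
have [pi|pi] := eqVneq p i; last first.
  rewrite (_ : entry _ _ _ = 0)//; apply: bop_ext => x /=.
  by rewrite coord_emb (negbTE pi).
have [kq|kq] := eqVneq k q; last first.
  rewrite (_ : entry _ _ _ = 0)//; apply: bop_ext => x /=.
  by rewrite (coord_emb k) (negbTE kq) !linear0.
rewrite (_ : entry _ _ _ = bop_comp m (bop_comp (entry Y j l) (adj n))).
  exact: AVA.
by apply: bop_ext => x /=; rewrite pi kq !coord_emb !eqxx.
Qed.

Lemma infinite_set_fresh (F : {fset I}) : infinite_set [set: I] -> exists i, i \notin F.
Proof.
move=> Iinf; apply/not_existsP => h; apply: Iinf.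
apply: sub_finite_set (finite_fset F) => i _ /=.
by apply/negPn/negP; exact: h.
Qed.

(** An infinite index set always has room for one more row.  As the rows outside [F]
    are zero and the vectors [f] live on [F], a new row does not disturb the
    vectors already in the range of the adjoint. *)
Lemma finite_matrices_range H K (M : set (bop H K)) (t : seq (I * bop H K * K)) :
    infinite_set [set: I] -> (forall p, p \in t -> M p.1.2) ->
  exists2 c, finite_matrices M c & exists F : {fset I},
    (forall i k, i \notin F -> adj c (emb K i k) = 0) /\
    forall p, p \in t -> exists2 f : hilbert_sum I K,
      (forall i, i \notin F -> f i = 0) & adj c f = emb H p.1.1 (adj p.1.2 p.2).
Proof.
move=> Iinf; have [M0 MD] := finite_matrices_subspace M.
have adj0 (x : hilbert_sum I K) :
    adj (0 : bop (hilbert_sum I H) (hilbert_sum I K)) x = 0.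
  by apply: inner_ext => y; rewrite -adjP inner0l inner0r.
elim: t => [|[[j m] k] t IH] tM.
  by exists 0 => //; exists fset0; split.
have [|c Mc [F [cF ct]]] := IH.
  by move=> p pt; apply: tM; rewrite inE pt orbT.
have [i iF] := infinite_set_fresh F Iinf.
have Mm : M m by apply: (tM (j, m, k)); rewrite mem_head.
(* the coefficient 1 gives the sum the shape required by adj_linear *)
exists (1 *: unit_matrix i j m + c).
  by apply: MD => //; exact: unit_matrix_finite.
have c'E f : adj (1 *: unit_matrix i j m + c) f = emb H j (adj m (f i)) + adj c f.
  by rewrite adj_linear rmorph1 scale1r adj_unit_matrix bopDE unit_matrixE.
exists (i |` F)%fset; split.
  move=> i' k'; rewrite !inE negb_or => /andP[i'i i'F].
  by rewrite c'E cF// addr0 embE eq_sym (negbTE i'i) !linear0.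
move=> p; rewrite inE => /predU1P[->|/ct[f fF fp]].
  exists (emb K i k).
    move=> i'; rewrite !inE negb_or => /andP[i'i _].
    by rewrite embE (negbTE i'i).
  by rewrite c'E cF// addr0 embE eqxx.
exists f.
  by move=> i'; rewrite !inE negb_or => /andP[_]; exact: fF.
by rewrite c'E fF// !linear0 add0r.
Qed.

(** The ranges of the adjoints of elements of [M] span a dense subspace, in the
    dual form in which it is used. *)
Definition nondegenerate H K (M : set (bop H K)) :=
  forall z, (forall m k, M m -> inner (adj m k) z = 0) -> z = 0.

Lemma finite_matrices_dense_range H K (M : set (bop H K)) (s : seq (hilbert_sum I H)) :
    infinite_set [set: I] -> nondegenerate M ->
  forall e : R[i], 0 < e -> exists2 c, finite_matrices M c &
    forall u, u \in s -> exists v, `|u - adj c v| <= e.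
Proof.
move=> Iinf Mnd e e0.
pose val (p : I * bop H K * K) := emb H p.1.1 (adj p.1.2 p.2).
have [t tM ts] : exists2 t : seq (I * bop H K * K), (forall p, p \in t -> M p.1.2) &
    forall u, u \in s -> exists2 v,
      linear_span [set val p | p in [set p | p \in t]] v & `|u - v| <= e.
  elim: s => [|u s [t tM ts]]; first by exists [::].
  have [||v [n [c [g [gP ->]]]] uv] := @dense_of_ortho R (hilbert_sum I H)
    [set val p | p in [set p | M p.1.2]] _ u e => //.
    move=> z zP; apply: hilbert_sum_ext => j; apply: Mnd => m k Mm.
    by rewrite -inner_emb; apply: zP; exists (j, m, k).
  have /choice[p pP] : forall i, exists p, M p.1.2 /\ val p = g i.
    by move=> i; have [p] := gP i; exists p.
  exists ([seq p i | i <- enum 'I_n] ++ t).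
    move=> q; rewrite mem_cat => /orP[/mapP[i _ ->]|/tM//].
    by have [] := pP i.
  move=> w; rewrite inE => /predU1P[->|/ts[v' [n' [c' [g' [g'P ->]]]] wv]].
    exists (\sum_i c i *: g i) => //; exists n, c, g; split=> // i.
    have [_ <-] := pP i; exists (p i) => //=.
    by rewrite mem_cat map_f// mem_enum.
  exists (\sum_i c' i *: g' i) => //; exists n', c', g'; split=> // i.
  have [q /= qt <-] := g'P i; exists q => //=.
  by rewrite mem_cat qt orbT.
have [c Mc [F [_ ct]]] := finite_matrices_range Iinf tM.
exists c => // u /ts[v vt uv].
suff [w wv] : exists w, adj c w = v by exists w; rewrite wv.
apply: (@linear_span_min _ _ _ [set v | exists w, adj c w = v] _ _ v vt).
  split; first by exists 0; exact: linear0.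
  by move=> a _ _ [x <-] [y <-]; exists (a *: x + y); exact: linearP.
by move=> _ [p /= /ct[f _ fp] <-]; exists f.
Qed.

Lemma finite_matrices_approximation H K (M : set (bop H K)) (s : seq (hilbert_sum I H)) :
    infinite_set [set: I] -> TRO M -> nondegenerate M ->
  forall e : R[i], 0 < e -> exists x, [/\ finite_matrices M x, bounded_by x 1 &
    forall u, u \in s -> `|defect x u| <= e].
Proof.
move=> Iinf MT Mnd; apply: tro_approximation; first exact: finite_matrices_TRO.
exact: finite_matrices_dense_range.
Qed.

End finite_matrices.

(** * Distances and the functional r *)

Section distances.
Context {R : realType}.
Implicit Types (H K : hilbertType R).
Local Notation "r %:RC" := (real_complex R r) (at level 2, format "r %:RC").

Lemma rnormE (V : normedModType R[i]) (x : V) : (rnorm x)%:RC = `|x|.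
Proof. by apply: RRe_real; exact: normr_real. Qed.

Lemma rnorm_ge0 (V : normedModType R[i]) (x : V) : 0 <= rnorm x.
Proof. by rewrite -ler0c rnormE. Qed.

Lemma opnorm_ge0 H K (T : bop H K) : 0 <= opnorm T.
Proof.
rewrite /opnorm; set E := [set _ | _ in _].
have E0 : E 0.
  by exists 0; rewrite /= /rnorm ?(linear0 T) normr0 ?ler01.
have [supE|supE] := pselect (has_sup E); first exact: sup_upper_bound.
by rewrite sup_out.
Qed.

Lemma opnorm_le H K (T : bop H K) r : bounded_by T r%:RC -> 0 <= r -> opnorm T <= r.
Proof.
move=> Tr r0; apply: ge_sup.
  by exists (rnorm (T 0)), 0 => //=; rewrite /rnorm normr0.
move=> _ [x /= x1 <-]; rewrite -lecR rnormE; apply: le_trans (Tr x) _.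
by rewrite -rnormE -rmorphM/= lecR ler_piMr.
Qed.

Lemma bounded_by_opnorm H K (T : bop H K) : bounded_by T (opnorm T)%:RC.
Proof.
move=> x; have [->|x0] := eqVneq x 0; first by rewrite (linear0 T) !normr0 mulr0.
have nx : 0 < `|x| by rewrite normr_gt0.
have [c c0 Tc] := bop_bounded T.
rewrite -ler_pdivrMr// mulrC -(@gtr0_norm _ `|x|^-1) ?invr_gt0// -normrZ.
have -> : `|x|^-1 *: T x = T (`|x|^-1 *: x) by apply/esym; exact: linearZ.
rewrite -rnormE lecR; apply: sup_upper_bound.
  split; first by exists (rnorm (T 0)), 0 => //=; rewrite /rnorm normr0.
  exists (complex.Re c) => _ [y /= y1 <-].
  have cE : (complex.Re c)%:RC = c by apply: RRe_real; exact: gtr0_real.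
  rewrite -lecR rnormE cE; apply: le_trans (Tc y) _.
  by rewrite ler_piMr ?(ltW c0)// -rnormE lecR.
exists (`|x|^-1 *: x) => //=; rewrite -lecR rnormE normrZ gtr0_norm ?invr_gt0//.
by rewrite mulVf ?gt_eqF.
Qed.

Lemma op_dist_le H K (X : set (bop H K)) T S r : X S -> 0 <= r ->
  bounded_by (T - S) r%:RC -> op_dist X T <= r.
Proof.
move=> XS r0 /opnorm_le/(_ r0); apply: le_trans; apply: inf_lbound.
  by exists 0 => _ [S' _ <-]; exact: opnorm_ge0.
by exists S.
Qed.

Lemma op_dist_lt H K (X : set (bop H K)) (T : bop H K) r : X 0 -> op_dist X T < r ->
  exists2 S, X S & bounded_by (T - S) r%:RC.
Proof.
move=> X0 dr; have d0 : 0 < r - op_dist X T by rewrite subr_gt0.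
have [|_ [S XS <-]] := @inf_adherent R [set opnorm (T - S) | S in X] _ d0.
  split; first by exists (opnorm (T - 0)), 0.
  by exists 0 => _ [S' _ <-]; exact: opnorm_ge0.
rewrite [ltRHS]addrC subrK => Sr; exists S => // x.
apply: le_trans (bounded_by_opnorm _ _) _.
by rewrite ler_wpM2r// lecR ltW.
Qed.

(** In the absence of admissible pairs, [op_r] is [sup set0 = 0], which explains the
    hypothesis [0 <= r]. *)
Lemma op_r_le H K (X : set (bop H K)) (T : bop H K) r : 0 <= r ->
    (forall x y, `|x| = 1 -> `|y| = 1 -> (forall S, X S -> inner (S x) y = 0) ->
      `|inner (T x) y| <= r%:RC) ->
  op_r X T <= r.
Proof.
move=> r0 h; rewrite /op_r; set E := [set _ | _].
have [[s Es]|E0] := pselect (E !=set0); last first.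
  rewrite (_ : E = set0) ?sup0//.
  by apply/seteqP; split=> // s Es; apply: E0; exists s.
apply: ge_sup; first by exists s.
move=> _ [x [y [x1 y1 Xxy ->]]]; rewrite -lecR.
have -> : (rnorm (inner (T x) y))%:RC = `|inner (T x) y|.
  by apply: RRe_real; exact: normr_real.
by apply: h => //; rewrite -rnormE ?x1 ?y1.
Qed.

Lemma op_r_ge H K (X : set (bop H K)) (T : bop H K) x y :
    rnorm x = 1 -> rnorm y = 1 -> (forall S, X S -> inner (S x) y = 0) ->
  rnorm (inner (T x) y) <= op_r X T.
Proof.
move=> x1 y1 Xxy; apply: sup_upper_bound; last by exists x, y.
split; first by exists (rnorm (inner (T x) y)), x, y.
exists (opnorm T) => _ [u [v [u1 v1 _ ->]]].
rewrite -lecR.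
have -> : (rnorm (inner (T u) v))%:RC = `|inner (T u) v|.
  by apply: RRe_real; exact: normr_real.
apply: le_trans (bounded_by_inner _ _ (@bounded_by_opnorm _ _ T)) _.
by rewrite -!rnormE u1 v1 !mulr1.
Qed.

Lemma op_r_ge0 H K (X : set (bop H K)) (T : bop H K) : 0 <= op_r X T.
Proof.
rewrite /op_r; set E := [set _ | _].
have [supE|supE] := pselect (has_sup E); last by rewrite sup_out.
have [[s Es] _] := supE; apply: le_trans (sup_upper_bound supE Es).
by case: Es => x [y [_ _ _ ->]]; exact: (@rnorm_ge0 R[i]^o).
Qed.

Lemma op_r_inner H K (X : set (bop H K)) (T : bop H K) x y :
    (forall S, X S -> inner (S x) y = 0) ->
  `|inner (T x) y| <= (op_r X T)%:RC * `|x| * `|y|.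
Proof.
move=> Xxy; have r0 := op_r_ge0 X T.
have [->|x0] := eqVneq x 0.
  by rewrite (linear0 T) inner0l !normr0 mulr0 mul0r.
have [->|y0] := eqVneq y 0.
  by rewrite inner0r !normr0 mulr0.
have nx : 0 < `|x| by rewrite normr_gt0.
have ny : 0 < `|y| by rewrite normr_gt0.
pose u := `|x|^-1 *: x; pose v := `|y|^-1 *: y.
have u1 : rnorm u = 1.
  apply: (@complexI R); rewrite rnormE rmorph1 normrZ gtr0_norm ?invr_gt0//.
  by rewrite mulVf ?gt_eqF.
have v1 : rnorm v = 1.
  apply: (@complexI R); rewrite rnormE rmorph1 normrZ gtr0_norm ?invr_gt0//.
  by rewrite mulVf ?gt_eqF.
have uvE (S : bop H K) : inner (S u) v = (`|x| * `|y|)^-1 * inner (S x) y.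
  have SZ : S u = `|x|^-1 *: S x by exact: linearZ.
  rewrite SZ innerZl innerZr conj_Creal ?rpredV ?normr_real//.
  by rewrite mulrA invfM.
have Xuv S : X S -> inner (S u) v = 0.
  by move=> XS; rewrite uvE Xxy// mulr0.
have := op_r_ge T u1 v1 Xuv; rewrite -lecR.
have -> : (rnorm (inner (T u) v))%:RC = `|inner (T u) v|.
  by apply: RRe_real; exact: normr_real.
rewrite uvE normrM gtr0_norm ?invr_gt0 ?mulr_gt0// ler_pdivrMl ?mulr_gt0//.
by rewrite mulrC mulrA.
Qed.

Lemma op_r_le_dist H K (X : set (bop H K)) (T : bop H K) : X 0 -> op_r X T <= op_dist X T.
Proof.
move=> X0; apply: lb_le_inf; first by exists (opnorm (T - 0)), 0.
move=> _ [S XS <-]; apply: op_r_le; first exact: opnorm_ge0.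
move=> x y x1 y1 Xxy; have := bounded_by_inner x y (@bounded_by_opnorm _ _ (T - S)).
by rewrite x1 y1 !mulr1 bopBE innerBl (Xxy S XS) subr0.
Qed.

Lemma op_dist0 H K (X : set (bop H K)) (T : bop H K) : X T -> op_dist X T <= 0.
Proof.
move=> XT; apply: (op_dist_le XT) => // x.
by rewrite subrr normr0 mul0r.
Qed.

(** An operator at distance [0] is approximated by elements of a fixed ball, so
    the compactness of the space applies with [c = 0]. *)
Lemma matrix_space_norm_closed (I : choiceType) H K (X : set (bop H K)) T :
    subspace_set X -> weakstar_closed X ->
    op_dist (matrix_space I X) T <= 0 -> matrix_space I X T.
Proof.
move=> Xs Xc T0; have [MX0 _] := @matrix_space_subspace R I _ _ _ Xs.
have t0 : 0 <= (opnorm T)%:RC by rewrite ler0c opnorm_ge0.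
have [||s1 s2 e e0|Y XY TY] := @matrix_space_compactness R I H K X T
  ((opnorm T)%:RC + 1) 0 Xc.
- by rewrite addr_ge0.
- by [].
- have [m [m0 [m1 me]]] : exists m : R, 0 < m /\ m%:RC <= 1 /\ m%:RC <= e.
    have eE : (complex.Re e)%:RC = e by apply: RRe_real; exact: gtr0_real.
    have re0 : 0 < complex.Re e by rewrite -ltcR eE.
    exists (Num.min 1 (complex.Re e)); split; first by rewrite lt_min ltr01.
    split; last by rewrite -[leRHS]eE lecR ge_min lexx orbT.
    by rewrite -[leRHS](rmorph1 (real_complex R)) lecR ge_min lexx.
  have [Y XY TY] := op_dist_lt MX0 (le_lt_trans T0 m0).
  exists Y; split=> // [x|x y _ _].
    rewrite (_ : Y x = T x - (T - Y) x); last by rewrite bopBE opprB addrC subrK.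
    apply: le_trans (ler_normB _ _) _; rewrite mulrDl mul1r lerD//.
      exact: bounded_by_opnorm.
    by apply: le_trans (TY x) _; rewrite ler_piMl.
  rewrite !mul0r add0r; apply: le_trans (bounded_by_inner _ _ TY) _.
  rewrite -mulrA mulrC; have m0' : 0 <= m%:RC by rewrite ler0c ltW.
  apply: ler_pM me => //.
  by apply: ler_pM; rewrite ?lerDr.
suff -> : T = Y by [].
apply: bop_ext => x; apply/eqP; rewrite -subr_eq0 -normr_le0.
by have := TY x; rewrite mul0r.
Qed.

End distances.

(** * Transfer along the equivalence *)

Section weakstar_functionals.
Context {R : realType}.
Implicit Types (H K : hilbertType R).

Lemma normal_eval_continuous H K p :
  continuous (fun T : weakstar H K => normal_eval T p : R[i]^o).
Proof.
move=> T; have fT : (@normal_eval R H K) @ (T : weakstar H K) -->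
    (normal_eval T : {ptws _ -> R[i]^o}).
  exact: (@initial_continuous _ _ (@normal_eval R H K : bop H K -> {ptws _ -> R[i]^o}) T).
have /cvg_sup/(_ p) ev : nbhs (normal_eval T : {ptws _ -> R[i]^o}) -->
   (normal_eval T : {ptws _ -> R[i]^o}) by [].
move=> B nB; apply: (fT [set g | B (g p)]); apply: ev.
exact: (@initial_continuous _ _ (fun g : _ -> R[i]^o => g p) (normal_eval T) B nB).
Qed.

(** [T |-> inner (T x) z] is the normal functional given by sequences with one
    nonzero term, so its kernel is weak* closed. *)
Lemma weakstar_closure_inner0 H K (X : set (bop H K)) x z :
    (forall T, X T -> inner (T x) z = 0) ->
  forall T, weakstar_closure (linear_span X) T -> inner (T x) z = 0.
Proof.
move=> Xxz T cT.
pose p := (hilbert_sum_single 0%N x, hilbert_sum_single 0%N z).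
have pE S : normal_eval S p = inner (S x) z.
  apply: csum_lim.
  have := @partial_sum_single R nat R[i]^o
    (fun n => inner (S (p.1 n)) (p.2 n)) 0%N.
  rewrite /= ; apply => n /negbTE ->; exact: inner0r.
apply/eqP; rewrite -normr_le0; apply/ler_addgt0Pl => e e0; rewrite addr0.
have := @normal_eval_continuous H K p T.
move/(@cvgrPdist_le R[i] R[i]^o)/(_ _ e0) => /cT[S [/= XS]].
rewrite !pE (_ : inner (S x) z = 0) ?subr0//.
apply: (@linear_span_min _ _ X [set S | inner (S x) z = 0] _ _ S XS) => //.
split=> [|a S1 S2 /= S1z S2z] /=; first exact: inner0l.
by rewrite innerDl innerZl S1z S2z mulr0 addr0.
Qed.

End weakstar_functionals.

Section weak_TRO.
Context {R : realType} {H1 H2 K1 K2 : hilbertType R}.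
Local Notation "r %:RC" := (real_complex R r) (at level 2, format "r %:RC").

(** What the compression argument takes from a weak TRO equivalence: single
    ternary products land in [U] and [V], and both TROs are nondegenerate. *)
Record TRO_link (U : set (bop K1 K2)) (V : set (bop H1 H2))
    (M1 : set (bop H1 K1)) (M2 : set (bop H2 K2)) : Prop := TROLink {
  link_TRO1 : TRO M1;
  link_TRO2 : TRO M2;
  link_up : forall m v n, M2 m -> V v -> M1 n ->
    U (bop_comp m (bop_comp v (adj n)));
  link_down : forall m u n, M2 m -> U u -> M1 n ->
    V (bop_comp (adj m) (bop_comp u n));
  link_nondegenerate1 : nondegenerate M1;
  link_nondegenerate2 : nondegenerate M2 }.

(** If [z] is orthogonal to the range of [m^*] for all [m] in [M2], then it is
    orthogonal to the range of every element of [linear_span (M2^* U M1)], hence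
    of every element of its weak* closure [V], so [z = 0] as [V] is essential.
    For [M1] the same reasoning applies to the kernels of its elements. *)
Lemma weak_TRO_link U V : essential V -> weak_TRO_equivalent U V ->
  exists M1 M2, TRO_link U V M1 M2.
Proof.
move=> [V2 V1] [M1 [M2 [M1T M2T UE VE]]]; exists M1, M2.
have Vgen x z : (forall m u n, M2 m -> U u -> M1 n ->
    inner (adj m (u (n x))) z = 0) -> forall v, V v -> inner (v x) z = 0.
  move=> h v; rewrite VE; apply: weakstar_closure_inner0.
  move=> _ [_ [m' /adjoint_setE Mm' [u Uu <-]] [n Mn <-]] /=.
  by rewrite -[m']adjK; exact: h.
split=> //.
- move=> m v n Mm Vv Mn; rewrite UE; apply: subset_closure.
  apply: sub_linear_span; exists (bop_comp m v).
    by exists m => //; exists v.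
  by exists (adj n); [apply/adjoint_setE; rewrite adjK|exact: bop_ext].
- move=> m u n Mm Uu Mn; rewrite VE; apply: subset_closure.
  apply: sub_linear_span; exists (bop_comp (adj m) u).
    by exists (adj m); [apply/adjoint_setE; rewrite adjK|exists u].
  by exists n => //; exact: bop_ext.
- move=> z zM; apply: (closure_ortho V1) => _ [S /adjoint_setE VS [y _ <-]].
  rewrite -[S]adjK -adjPr innerC (Vgen _ _ _ _ VS) ?rmorph0// => m u n Mm Uu Mn.
  have nz : n z = 0 by apply: inner_ext => k; rewrite adjPr zM// inner0r.
  by rewrite nz (linear0 u) (linear0 (adj m)) inner0l.
- move=> z zM; apply: (closure_ortho V2) => _ [v Vv [x _ <-]].
  by apply: Vgen Vv => m u n Mm _ _; exact: zM.
Qed.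

(** The compression argument: [r] does not increase from [T] to [T'], and an
    element of the matrix space over [U] close to [T'] is compressed back to one
    over [V], which is close to [T] on the given vectors. *)
Lemma op_dist_transfer (I : choiceType) U V M1 M2 (k : R) :
    TRO_link U V M1 M2 -> subspace_set U -> subspace_set V ->
    weakstar_closed V -> infinite_set [set: I] -> 0 <= k ->
    (forall T, op_dist (matrix_space I U) T <= k * op_r (matrix_space I U) T) ->
  forall T, op_dist (matrix_space I V) T <= k * op_r (matrix_space I V) T.
Proof.
move=> [M1T M2T up down nd1 nd2] Us Vs Vc Iinf k0 dU T.
have [MU0 _] := @matrix_space_subspace R I _ _ _ Us.
set r := op_r _ T; have r0 : 0 <= r := op_r_ge0 _ _.
apply/ler_addgt0Pr => d d0.
pose c := k * r + d; have c0 : 0 < c by rewrite ltr_wpDl// mulr_ge0.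
have cC : 0 <= c%:RC by rewrite ler0c ltW.
pose t := (opnorm T)%:RC; have t0 : 0 <= t by rewrite ler0c opnorm_ge0.
have Tt : bounded_by T t := @bounded_by_opnorm _ _ _ T.
suff [Y VY TY] : exists2 Y, matrix_space I V Y & bounded_by (T - Y) c%:RC.
  exact: op_dist_le VY (ltW c0) TY.
apply: (@matrix_space_compactness R I H1 H2 V T (c%:RC + t)) => //.
  exact: addr_ge0.
move=> s1 s2 e e0.
(* the denominator compensates for the norm t of T in the error terms *)
have e'0 : 0 < e / (t + 1) by rewrite divr_gt0// ltr_wpDl.
have [W1 [W1M W1c W1s]] := finite_matrices_approximation s1 Iinf M1T nd1 e'0.
have [W2 [W2M W2c W2s]] := finite_matrices_approximation s2 Iinf M2T nd2 e'0.
pose T' := bop_comp W2 (bop_comp T (adj W1)).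
have contr (G G' : hilbertType R) (S : bop G G') x : bounded_by S 1 -> `|S x| <= `|x|.
  by move=> S1; have := S1 x; rewrite mul1r.
have rT' : op_r (matrix_space I U) T' <= r.
  apply: op_r_le => // x y x1 y1 Uxy.
  rewrite /T' /= adjP.
  have Vxy S : matrix_space I V S -> inner (S (adj W1 x)) (adj W2 y) = 0.
    move=> VS; rewrite -adjP; apply: (Uxy (bop_comp W2 (bop_comp S (adj W1)))).
    exact: matrix_space_transfer up W2M W1M VS.
  apply: le_trans (op_r_inner T Vxy) _.
  rewrite -/r -mulrA ler_piMr ?ler0c// -[leRHS]mulr1.
  apply: ler_pM => //.
    by rewrite -x1; apply: contr; exact: adj_bounded.
  by rewrite -y1; apply: contr; exact: adj_bounded.
have [X UX T'X] : exists2 X, matrix_space I U X & bounded_by (T' - X) c%:RC.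
  apply: op_dist_lt => //; apply: le_lt_trans (dU T') _.
  by rewrite (@le_lt_trans _ _ (k * r))// ?ler_wpM2l// ltrDl.
exists (bop_comp (adj W2) (bop_comp X W1)); split.
- rewrite -[W1]adjK.
  apply: matrix_space_transfer Vs _ (adj_finite_matrices W2M)
    (adj_finite_matrices W1M) UX.
  move=> m u n /adjoint_setE Mm Uu /adjoint_setE Mn.
  by rewrite -[m]adjK; exact: down.
- have Xb : bounded_by X (c%:RC + t).
    move=> x; rewrite (_ : X x = T' x - (T' - X) x); last first.
      by rewrite bopBE opprB addrC subrK.
    apply: le_trans (ler_normB _ _) _; rewrite addrC mulrDl lerD//.
    apply: le_trans (contr _ _ W2 _ W2c) _; apply: le_trans (Tt _) _.
    by rewrite ler_wpM2l// contr//; exact: adj_bounded.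
  move=> x; apply: le_trans (contr _ _ (adj W2) _ (adj_bounded ler01 W2c)) _.
  by apply: le_trans (Xb _) _; rewrite ler_wpM2l ?addr_ge0// contr.
- move=> x y xs ys.
  have -> : inner ((T - bop_comp (adj W2) (bop_comp X W1)) x) y =
      inner ((T' - X) (W1 x)) (W2 y) +
      (inner (T (defect W1 x)) y + inner (T (adj W1 (W1 x))) (defect W2 y)).
    have TB u v : T (u - v) = T u - T v by exact: linearB.
    have YE : bop_comp (adj W2) (bop_comp X W1) x = adj W2 (X (W1 x)) by [].
    have T'E : T' (W1 x) = W2 (T (adj W1 (W1 x))) by [].
    rewrite !bopBE !innerBl /defect TB innerBl innerBr YE T'E.
    by rewrite (adjP (adj W2)) adjK (adjP W2); ring.
  apply: le_trans (ler_normD _ _) _; apply: lerD.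
    apply: le_trans (bounded_by_inner _ _ T'X) _.
    by apply: ler_pM; rewrite ?mulr_ge0// ?ler_wpM2l// contr.
  apply: (@le_trans _ _ (t * (e / (t + 1)) * `|y| + t * `|x| * (e / (t + 1)))).
    apply: le_trans (ler_normD _ _) _; apply: lerD.
      apply: le_trans (bounded_by_inner _ _ Tt) _.
      by rewrite ler_wpM2r// ler_wpM2l// W1s.
    apply: le_trans (bounded_by_inner _ _ Tt) _.
    apply: ler_pM; rewrite ?mulr_ge0 ?W2s// ler_wpM2l//.
    apply: le_trans (contr _ _ (adj W1) _ (adj_bounded ler01 W1c)) _.
    exact: contr.
  rewrite (_ : _ + _ = (t / (t + 1)) * ((`|x| + `|y|) * e)); last first.
    by field; rewrite gt_eqF// ltr_wpDl.
  apply: (@le_trans _ _ ((`|x| + `|y|) * e)).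
    rewrite ler_piMl ?mulr_ge0 ?addr_ge0 ?(ltW e0)//.
    by rewrite ler_pdivrMr ?ltr_wpDl// mul1r lerDl.
  rewrite ler_wpM2r ?(ltW e0)// -subr_ge0.
  rewrite (_ : _ - _ = 1 + `|x| * `|y|); last by ring.
  by rewrite addr_ge0// mulr_ge0.
Qed.

(** When the space over [U] is hyperreflexive and proper, its constant is a real
    number [k' >= 1] that satisfies the distance estimate for all operators, so
    the estimate passes to [V].  The bound [1 <= k'] also covers the case in
    which the space over [V] is everything.  When the space over [U] is
    everything, the estimate holds with the constant [0], and the space over [V]
    is everything as well. *)
Lemma hyperreflexivity_constant_le (I : choiceType) U V M1 M2 :
    TRO_link U V M1 M2 -> subspace_set U -> subspace_set V ->
    weakstar_closed U -> weakstar_closed V -> infinite_set [set: I] ->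
  (hyperreflexivity_constant (matrix_space I V) <=
    hyperreflexivity_constant (matrix_space I U))%E.
Proof.
move=> UV Us Vs Uc Vc Iinf.
have le_k := op_dist_transfer UV Us Vs Vc Iinf.
have Uclosed T : op_dist (matrix_space I U) T <= 0 -> matrix_space I U T.
  exact: matrix_space_norm_closed.
have Vclosed T : op_dist (matrix_space I V) T <= 0 -> matrix_space I V T.
  exact: matrix_space_norm_closed.
have [MU0 _] := @matrix_space_subspace R I _ _ _ Us.
rewrite {2}/hyperreflexivity_constant.
case: asboolP => [UT|/eqP UT].
  have VT : matrix_space I V = setT.
    apply/seteqP; split=> // T _; apply: Vclosed.
    rewrite -[leRHS](mul0r (op_r (matrix_space I V) T)).
    apply: le_k => // S; rewrite mul0r; apply: op_dist0.
    by rewrite UT.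
  by rewrite /hyperreflexivity_constant; case: asboolP.
case: asboolP => [[k k0 dk]|_]; last by rewrite leey.
set s := ereal_sup _.
have ratio_le T : (op_dist (matrix_space I U) T / op_r (matrix_space I U) T <= k)%R.
  have := op_r_ge0 (matrix_space I U) T; rewrite le_eqVlt => /predU1P[<-|r0].
    by rewrite invr0 mulr0 ltW.
  by rewrite ler_pdivrMr.
have [T0 UT0] : exists T, ~ matrix_space I U T.
  apply/not_existsP => h; move/eqP : UT; apply; apply/seteqP; split=> // T _.
  by apply: contrapT; exact: h.
have r_gt0 T : ~ matrix_space I U T -> 0 < op_r (matrix_space I U) T.
  move=> UT'; rewrite lt_def op_r_ge0 andbT; apply/eqP => r0; apply: UT'.
  by apply: Uclosed; rewrite (le_trans (dk T))// r0 mulr0.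
have s_ge1 : (1 <= s)%E.
  apply: (@le_trans _ _ (op_dist (matrix_space I U) T0 / op_r (matrix_space I U) T0)%:E).
    by rewrite lee_fin ler_pdivlMr ?r_gt0// mul1r op_r_le_dist.
  by apply: ereal_sup_ubound; exists T0.
have s_le : (s <= k%:E)%E.
  by apply: ge_ereal_sup => _ [T _ <-]; rewrite lee_fin.
(* the supremum is finite, since k bounds it and 1 is below it *)
have [k' sE] : exists k' : R, s = k'%:E.
  exists (fine s); rewrite fineK// fin_numE; apply/andP; split.
    by rewrite gt_eqF// (lt_le_trans _ s_ge1)// ltNyr.
  by rewrite lt_eqF// (le_lt_trans s_le)// ltry.
have k'1 : 1 <= k' by rewrite -lee_fin -sE.
have dU T : op_dist (matrix_space I U) T <= k' * op_r (matrix_space I U) T.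
  have [UT'|UT'] := pselect (matrix_space I U T).
    rewrite (le_trans (op_dist0 UT'))// mulr_ge0 ?op_r_ge0//.
    exact: le_trans k'1.
  rewrite -ler_pdivrMr ?r_gt0// -lee_fin -sE.
  by apply: ereal_sup_ubound; exists T.
have dV := le_k k' (le_trans ler01 k'1) dU.
rewrite /hyperreflexivity_constant; case: asboolP => // _.
case: asboolP => [_|]; last first.
  by case; exists k' => //; exact: lt_le_trans k'1.
apply: ge_ereal_sup => _ [T _ <-]; rewrite sE lee_fin.
have := op_r_ge0 (matrix_space I V) T; rewrite le_eqVlt => /predU1P[<-|r0].
  by rewrite invr0 mulr0 (le_trans ler01).
by rewrite ler_pdivrMr.
Qed.

End weak_TRO.

Section symmetry.
Context {R : realType}.
Implicit Types (H K : hilbertType R).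

Lemma adjoint_setK H K (X : set (bop H K)) : adjoint_set (adjoint_set X) = X.
Proof.
apply/seteqP; split=> T.
  by move=> /adjoint_setE/adjoint_setE; rewrite adjK.
by move=> XT; apply/adjoint_setE/adjoint_setE; rewrite adjK.
Qed.

Lemma adjoint_set_TRO H K (M : set (bop H K)) : TRO M -> TRO (adjoint_set M).
Proof.
move=> MT; have [[M0 MD] _] := MT; split.
  split.
    apply/adjoint_setE; rewrite (_ : adj 0 = 0)//.
    by apply/esym/adj_unique => x y; rewrite inner0l inner0r.
  move=> a x y /adjoint_setE Mx /adjoint_setE My; apply/adjoint_setE.
  by rewrite adj_linear; exact: MD.
move=> _ [_ [x /adjoint_setE Mx [y + <-]] [z /adjoint_setE Mz <-]].
rewrite adjoint_setK => My; apply/adjoint_setE; rewrite !adj_comp.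
rewrite -[y]adjK; by apply: TRO_triple; rewrite ?adjK.
Qed.

Lemma weak_TRO_equivalent_sym (H1 H2 K1 K2 : hilbertType R)
    (U : set (bop K1 K2)) (V : set (bop H1 H2)) :
  weak_TRO_equivalent U V -> weak_TRO_equivalent V U.
Proof.
move=> [M1 [M2 [M1T M2T UE VE]]]; exists (adjoint_set M1), (adjoint_set M2).
by split; rewrite ?adjoint_setK//; exact: adjoint_set_TRO.
Qed.

End symmetry.

Unset Implicit Arguments.

Theorem theorem3p6 (R : realType) (H1 H2 K1 K2 : hilbertType R)
    (U : set (bop K1 K2)) (V : set (bop H1 H2))
    (Usub : subspace_set U) (Vsub : subspace_set V)
    (Uclosed : weakstar_closed U) (Vclosed : weakstar_closed V)
    (Uess : essential U) (Vess : essential V)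
    (UV : weak_TRO_equivalent U V) :
  (forall (I : choiceType) (E1 : set H1) (E2 : set H2),
     infinite_set [set: I] ->
     orthonormal_basis E1 -> orthonormal_basis E2 ->
     E1 #<= [set: I] -> E2 #<= [set: I] ->
     (hyperreflexivity_constant (matrix_space I V) <=
      hyperreflexivity_constant (matrix_space I U))%E) /\
  (separable H1 -> separable H2 -> separable K1 -> separable K2 ->
     hyperreflexivity_constant (matrix_space nat V) =
     hyperreflexivity_constant (matrix_space nat U)).
Proof.
have [M1 [M2 link]] := weak_TRO_link Vess UV.
have [N1 [N2 link']] := weak_TRO_link Uess (weak_TRO_equivalent_sym UV).
split=> [I E1 E2 Iinf _ _ _ _|_ _ _ _].
  exact: hyperreflexivity_constant_le link Usub Vsub Uclosed Vclosed Iinf.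
have natinf := infinite_nat.
apply/eqP; rewrite eq_le; apply/andP; split.
  exact: hyperreflexivity_constant_le link Usub Vsub Uclosed Vclosed natinf.
exact: hyperreflexivity_constant_le link' Vsub Usub Vclosed Uclosed natinf.
Qed.
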